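(* Let $(M,g)$ be a simply connected compact Riemannian symmetric space of dimension $m\ge2$ and let $r_M=\sup_{x,y\in M}d_g(x,y)$. Let $\phi:[0,r_M]\to[0,\infty)$ satisfy: (1) $\phi$ is nonnegative, increasing and Lipschitz continuous on $[0,r_M]$; (2) $\phi$ is twice continuously differentiable on $(0,r_M)$ and $\phi'$ is bounded on $(0,r_M)$; (3) $\int_0^{r_M}|\phi''(r)|\,r^{m-1}\,dr<\infty$. Let $f(x;\alpha,\phi)=\frac{1}{Z(\phi)}e^{-\phi(d_g(x,\alpha))}$, let $\alpha^*\in M$, $D>0$, $\mathcal X=\{\alpha\in M:d_g(\alpha,\alpha^* )<D\}$, and define the minimax risk $$\mathcal R_n(\phi)=\inf_{\hat\alpha}\sup_{\alpha\in\mathcal X}\mathbb E\big[d_g(\hat\alpha(x_1,\dots,x_n),\alpha)\big],$$ where the infimum is over all estimators (measurable maps $\hat\alpha:M^n\to M$) and the expectation is over independent samples $x_1,\dots,x_n$ from $f(\cdot;\alpha,\phi)$. Then there is a constant $C>0$ independent of $n$ such that, for all sufficiently large $n$, $$\mathcal R_n(\phi)\ge Cn^{-1/2}.$$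
   Context: A Riemannian manifold is symmetric if for each point $x$ there is an isometry fixing $x$ and acting on $T_xM$ as minus the identity. Simply connected spaces are connected. $d_g$ is the geodesic distance, $\mathrm{dvol}$ the Riemannian volume measure. ''Increasing'' means nondecreasing. $Z(\phi)=\int_M e^{-\phi(d_g(x,\alpha))}\,\mathrm{dvol}(x)$, which is independent of $\alpha$ and finite (integrability is automatic since $M$ is compact). *)

(* Defs.v *)
From HB Require Import structures.
From mathcomp Require Import all_boot all_order all_algebra.
From mathcomp Require Import all_classical all_reals all_analysis.

Set Implicit Arguments.
Unset Strict Implicit.
Unset Printing Implicit Defensive.

Import Order.TTheory GRing.Theory Num.Theory.
Import numFieldNormedType.Exports.

Local Open Scope classical_set_scope.
Local Open Scope ring_scope.

Section tuple_cons_measure.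
Context d (T : measurableType d) (R : realType) (n : nat).
Variable mu : {sigma_finite_measure set T -> \bar R}.
Variable nu : {sigma_finite_measure set (n.-tuple T) -> \bar R}.

Let tcons (p : T * n.-tuple T) : n.+1.-tuple T :=
  [the n.+1.-tuple T of p.1 :: p.2].

Let measurable_tcons : measurable_fun setT tcons.
Proof. exact: measurable_cons. Qed.

Definition tuple_cons_measure : set (n.+1.-tuple T) -> \bar R :=
  pushforward (mu \x nu)%E tcons.

Let tuple_cons_measure0 : tuple_cons_measure set0 = 0%E.
Proof. by rewrite /tuple_cons_measure /pushforward preimage_set0 measure0. Qed.

Let tuple_cons_measure_ge0 A : (0 <= tuple_cons_measure A)%E.
Proof. by rewrite /tuple_cons_measure /pushforward measure_ge0. Qed.

Let tuple_cons_measure_sigma_additive :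
  semi_sigma_additive tuple_cons_measure.
Proof.
move=> F mF tF mUF; rewrite /tuple_cons_measure /pushforward preimage_bigcup.
have mpre B : measurable B -> measurable (tcons @^-1` B).
  by move=> mB; rewrite -[X in measurable X]setTI; exact: measurable_tcons.
apply: measure_semi_sigma_additive.
- by move=> k; apply: mpre; exact: mF.
- apply/trivIsetP => /= i j _ _ ij; rewrite -preimage_setI.
  by move/trivIsetP : tF => /(_ _ _ _ _ ij) ->//; rewrite preimage_set0.
- by rewrite -preimage_bigcup; exact: mpre.
Qed.

HB.instance Definition _ := isMeasure.Build _ _ _ tuple_cons_measure
  tuple_cons_measure0 tuple_cons_measure_ge0 tuple_cons_measure_sigma_additive.

Let tuple_cons_measure_sigma_finite : sigma_finite setT tuple_cons_measure.
Proof.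
have [G TG Goo] : sigma_finite setT (mu \x nu)%E.
  have /sigma_finiteP[F [TF ndF Foo]] := sigma_finiteT mu.
  have /sigma_finiteP[G [TG ndG Goo]] := sigma_finiteT nu.
  exists (fun k => F k `*` G k).
    rewrite -setXTT TF TG predeqE => -[x y]; split; last first.
      by move=> [k _ []/= ? ?]; split; exists k.
    move=> [/= [k _ Fkx] [l _ Gly]]; exists (maxn k l) => //; split.
    - by move: x Fkx; exact/subsetPset/ndF/leq_maxl.
    - by move: y Gly; exact/subsetPset/ndG/leq_maxr.
  move=> k; have [? ?] := Foo k; have [? ?] := Goo k.
  split; first exact: measurableX.
  by rewrite product_measure1E// lte_mul_pinfty// ge0_fin_numE.
pose u (t : n.+1.-tuple T) : T * n.-tuple T := (thead t, [tuple of behead t]).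
have mu_ : measurable_fun setT u.
  apply/measurable_fun_pairP; split.
  - exact: measurable_tnth.
  - exact: measurable_behead.
have uK p : u (tcons p) = p.
  case: p => x t; rewrite /u /tcons /= theadE; congr (_, _); exact/val_inj.
exists (fun k => u @^-1` G k).
  by rewrite -preimage_bigcup -TG preimage_setT.
move=> k; have [mG Gfin] := Goo k; split.
  by rewrite -[X in measurable X]setTI; exact: mu_.
rewrite /tuple_cons_measure /pushforward -comp_preimage.
by rewrite (_ : u \o tcons = id) //; apply/funext => p; exact: uK.
Qed.

HB.instance Definition _ := Measure_isSigmaFinite.Build _ _ _ tuple_cons_measure
  tuple_cons_measure_sigma_finite.

End tuple_cons_measure.

Fixpoint power_measure d (T : measurableType d) (R : realType)
    (mu : {sigma_finite_measure set T -> \bar R}) (n : nat) :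
    {sigma_finite_measure set (n.-tuple T) -> \bar R} :=
  match n with
  | 0 => \d_([tuple] : 0.-tuple T)
  | n'.+1 => tuple_cons_measure mu (power_measure mu n')
  end.

(* Meant for open [U]: only the germs of [f] at points of [U] matter. *)
Fixpoint Ck_on (R : realType) (m : nat) (V : normedModType R) (k : nat)
    (U : set 'rV[R]_m) (f : 'rV[R]_m -> V) : Prop :=
  match k with
  | 0 => forall x, U x -> {for x, continuous f}
  | k'.+1 => (forall x, U x -> differentiable f x) /\
             (forall v, Ck_on k' U (fun x => 'D_v f x))
  end.

Definition smooth_on (R : realType) (m : nat) (V : normedModType R)
    (U : set 'rV[R]_m) (f : 'rV[R]_m -> V) : Prop :=
  forall k, Ck_on k U f.

(* An [m]-dimensional smooth manifold structure on [M], given by a smooth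
   atlas. [param i] is the inverse of the chart [coord i : dom i -> 'rV_m];
   outside [dom i] and its image both are arbitrary. *)
Record smooth_atlas (R : realType) (m : nat) (M : topologicalType) :=
  SmoothAtlas {
  chart : Type;
  dom : chart -> set M;
  coord : chart -> M -> 'rV[R]_m;
  param : chart -> 'rV[R]_m -> M;
  chart_at : M -> chart;
  atlas_hausdorff : hausdorff_space M;
  atlas_second_countable : @second_countable M;
  dom_open : forall i, open (dom i);
  image_open : forall i, open (coord i @` dom i);
  dom_chart_at : forall x, dom (chart_at x) x;
  coordK : forall i x, dom i x -> param i (coord i x) = x;
  coord_continuous : forall i x, dom i x -> {for x, continuous (coord i)};
  param_continuous : forall i y, (coord i @` dom i) y ->
    {for y, continuous (param i)};
  transition_smooth : forall i j,
    smooth_on (coord i @` (dom i `&` dom j)) (coord j \o param i)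
}.

(* [gram i y] is the Gram matrix of the metric at the point of coordinates [y]
   in the chart [i]. As vectors are rows, the differential of [f] at [y] is
   [v |-> v *m 'J f y]. *)
Record riemannian_metric (R : realType) (m : nat) (M : topologicalType)
    (A : smooth_atlas R m M) := RiemannianMetric {
  gram : chart A -> 'rV[R]_m -> 'M[R]_m;
  gram_smooth : forall i, smooth_on (coord i @` dom i) (gram i);
  gram_sym : forall i y, (coord i @` dom i) y -> (gram i y)^T = gram i y;
  gram_posdef : forall i y, (coord i @` dom i) y ->
    forall v : 'rV[R]_m, v != 0 -> 0 < (v *m gram i y *m v^T) 0 0;
  gram_transition : forall i j y, (coord i @` (dom i `&` dom j)) y ->
    let J := 'J (coord j \o param i) y in
    gram i y = J *m gram j (coord j (param i y)) *m J^T
}.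

Section Riemannian.
Context (R : realType) (m : nat) (M : topologicalType).
Variables (A : smooth_atlas R m M) (g : riemannian_metric A).

Definition local_rep (s : M -> M) (i j : chart A) : 'rV[R]_m -> 'rV[R]_m :=
  coord j \o s \o param i.

Definition local_rep_dom (s : M -> M) (i j : chart A) : set 'rV[R]_m :=
  coord i @` (dom i `&` s @^-1` dom j).

Definition smooth_map (s : M -> M) : Prop :=
  continuous s /\
  forall i j, smooth_on (local_rep_dom s i j) (local_rep s i j).

Definition preserves_metric (s : M -> M) : Prop :=
  forall i j y, local_rep_dom s i j y ->
    let J := 'J (local_rep s i j) y in
    gram g i y = J *m gram g j (local_rep s i j y) *m J^T.

Definition isometry (s : M -> M) : Prop :=
  [/\ smooth_map s,
      exists2 t, smooth_map t & cancel s t /\ cancel t s &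
      preserves_metric s].

Definition symmetric_space : Prop :=
  forall x, exists s, [/\ isometry s, s x = x &
    let i := chart_at A x in 'J (local_rep s i i) (coord i x) = - 1%:M].

(* [c] restricted to [0, 1] is a C^1 curve; the derivative at the endpoints is
   two-sided, which is harmless since a C^1 curve on [0, 1] extends to a C^1
   curve on a neighbourhood of [0, 1]. *)
Definition C1_curve (c : R -> M) : Prop :=
  forall t, 0 <= t <= 1 ->
    {for t, continuous c} /\
    forall i, dom i (c t) ->
      (\forall s \near t, derivable (coord (s := A) i \o c) s 1) /\
      {for t, continuous (derive1 (coord (s := A) i \o c))}.

Definition speed (c : R -> M) (t : R) : R :=
  let i := chart_at A (c t) in
  let v := derive1 (coord i \o c) t in
  Num.sqrt ((v *m gram g i (coord i (c t)) *m v^T) 0 0).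

Definition C1_length (c : R -> M) : R :=
  \int[lebesgue_measure]_(t in `[0, 1]) speed c t.

(* [piecewise_C1 x y L]: some piecewise C^1 curve (a finite concatenation of
   C^1 curves) of length [L] goes from [x] to [y]. *)
Inductive piecewise_C1 : M -> M -> R -> Prop :=
  | piecewise_C1_nil x : piecewise_C1 x x 0
  | piecewise_C1_cons c y L : C1_curve c -> piecewise_C1 (c 1) y L ->
      piecewise_C1 (c 0) y (C1_length c + L).

Definition geodesic_dist (x y : M) : R := inf [set L | piecewise_C1 x y L].

Definition diameter : R :=
  sup [set geodesic_dist p.1 p.2 | p in [set: M * M]].

End Riemannian.

Definition simply_connected (R : realType) (M : topologicalType) : Prop :=
  (forall x y : M, exists c : R -> M,
     [/\ {within `[0, 1], continuous c}, c 0 = x & c 1 = y]) /\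
  (forall c : R -> M, {within `[0, 1], continuous c} -> c 0 = c 1 ->
     exists H : R * R -> M,
       [/\ {within `[0, 1] `*` `[0, 1], continuous H},
           forall t, 0 <= t <= 1 -> H (0, t) = c t,
           forall t, 0 <= t <= 1 -> H (1, t) = c 0 &
           forall s, 0 <= s <= 1 -> H (s, 0) = c 0 /\ H (s, 1) = c 0]).

Definition borel (M : ptopologicalType) := g_sigma_algebraType (@open M).

Definition row_of_tuple (R : realType) (m : nat)
    (t : m.-tuple (measurableTypeR R)) : 'rV[R]_m :=
  \row_k tnth t k.

(* The Riemannian volume is the Borel measure that reads
   [sqrt (det gram) dy_1 .. dy_m] in every chart. *)
Definition riemannian_volume (R : realType) (m : nat) (M : ptopologicalType)
    (A : smooth_atlas R m M) (g : riemannian_metric A)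
    (vol : set (borel M) -> \bar R) : Prop :=
  forall i (B : set (borel M)), measurable B -> B `<=` dom i ->
    vol B =
    (\int[power_measure (@lebesgue_measure R) m]_(t in
       [set t | (coord (s := A) i @` B) (row_of_tuple t)])
       (Num.sqrt (\det (gram g i (row_of_tuple t))))%:E)%E.

Section Model.
Context (R : realType) (m : nat) (M : ptopologicalType).
Variables (A : smooth_atlas R m M) (g : riemannian_metric A).
Variable vol : {sigma_finite_measure set (borel M) -> \bar R}.
Variable phi : R -> R.

(* By homogeneity a symmetric space gives the same value for every [a]. *)
Definition partition_function (a : M) : R :=
  \int[vol]_x expR (- phi (geodesic_dist g x a)).

Definition density (a x : M) : R :=
  (partition_function a)^-1 * expR (- phi (geodesic_dist g x a)).

(* The joint density of [n] independent samples is taken with respect to the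
   [n]-fold product of the volume. *)
Definition risk (n : nat) (est : n.-tuple (borel M) -> borel M) (a : M) :
    \bar R :=
  (\int[power_measure vol n]_t
     (geodesic_dist g (est t) a * \prod_(k < n) density a (tnth t k))%:E)%E.

Definition minimax_risk (X : set M) (n : nat) : \bar R :=
  ereal_inf [set ereal_sup [set risk est a | a in X] |
    est in [set est : n.-tuple (borel M) -> borel M | measurable_fun setT est]].

End Model.

(* Main.v *)
(* Le Cam's two-point method. The triangle inequality and the Lipschitz bound on
   [phi] give [|phi (d x a) - phi (d x b)| <= lip * d a b], so the densities
   centred at [a] and [b], normalizations included, agree up to a factor
   [exp (2 * lip * d a b)]; hence their affinity is [1 - O((d a b)^2)] and the
   [n]-sample experiments stay indistinguishable when [d a b = c / sqrt n]. As
   [d] is continuous and [M] is connected, such a [b] exists once [d] is not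
   identically zero; this is shown by bounding from below the length of curves
   by the variation of a C^1 bump function supported in a chart. *)

Require Import Defs.
From HB Require Import structures.
From mathcomp Require Import all_boot all_order all_algebra.
From mathcomp Require Import all_classical all_reals all_analysis.
From mathcomp Require Import measurable_realfun ring lra.

Set Implicit Arguments.
Unset Strict Implicit.
Unset Printing Implicit Defensive.

Import Order.TTheory GRing.Theory Num.Theory.
Import numFieldNormedType.Exports.

Local Open Scope classical_set_scope.
Local Open Scope ring_scope.

(** * Two-point lower bounds for product measures *)

(** [geodesic_dist] is a real infimum over all piecewise C^1 curves, which has two consequences. It
    means something only once every two points are known to be joined by such curves. A positive
    lower bound must also hold for curves that leave the chart, so the test function has to live on
    all of [M]: extended by zero, it is still C^1 along curves because its support is closed in [M].
    Compactness gives the volume a finite total mass and bounds all distances by [diameter], the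
    range on which [phi] is controlled. The two laws are compared through the single number
    [eps = lip * d a b]. The weight and the normalization each contribute one factor of at least
    [1 - eps]. The resulting square is the natural shape here, since the affinity involves the
    square roots of the densities. The requirement on the sample size is then [n * eps^2 <= 1/4],
    which fixes the scale [1 / sqrt n]. *)

Lemma le_integral_ge0 d (T : measurableType d) (R : realType)
    (mu : {measure set T -> \bar R}) (D : set T) (f1 f2 : T -> \bar R) :
  (forall x, D x -> (0 <= f1 x)%E) -> (forall x, D x -> (f1 x <= f2 x)%E) ->
  (\int[mu]_(x in D) f1 x <= \int[mu]_(x in D) f2 x)%E.
Proof.
move=> f10 f12.
have f20 x : D x -> (0 <= f2 x)%E by move=> Dx; exact: le_trans (f10 _ Dx) (f12 _ Dx).
(* Both integrals are suprema over the simple functions below the integrand, and the family on the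
   left is contained in the one on the right. *)
rewrite !ge0_integralE//; apply: le_ereal_sup => _ [h hf <-]; exists h => // x.
apply: le_trans (hf x) _; rewrite /patch; case: ifPn => // /set_mem; exact: f12.
Qed.

Lemma measurable_prod_tnth d (T : measurableType d) (R : realType) n
    (h : 'I_n -> T -> R) : (forall k, measurable_fun setT (h k)) ->
  measurable_fun setT (fun t : n.-tuple T => \prod_(k < n) h k (tnth t k)).
Proof.
move=> mh; apply: measurable_prod => k _.
by apply: (measurableT_comp (mh k)); exact: measurable_tnth.
Qed.

(** Tonelli, one coordinate at a time. The factor may change with the coordinate, so that the
    formula serves both joint densities and, with indicators, measures of boxes. *)
Lemma integral_power_measure d (T : measurableType d) (R : realType)
    (mu : {sigma_finite_measure set T -> \bar R}) n (h : 'I_n -> T -> R)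
    (I : 'I_n -> R) :
  (forall k, measurable_fun setT (h k)) -> (forall k x, 0 <= h k x) ->
  (forall k, \int[mu]_x (h k x)%:E = (I k)%:E)%E ->
  (\int[power_measure mu n]_t (\prod_(k < n) h k (tnth t k))%:E =
   (\prod_(k < n) I k)%:E)%E.
Proof.
elim: n h I => [|n IHn] h I mh h0 hI.
  rewrite /= integral_dirac//; first by rewrite diracT mul1e !big_ord0.
  by apply/measurable_EFinP; exact: measurable_prod_tnth.
have mF : measurable_fun setT
    (fun t : n.+1.-tuple T => (\prod_(k < n.+1) h k (tnth t k))%:E).
  by apply/measurable_EFinP; exact: measurable_prod_tnth.
have mc : measurable_fun setT
    (fun p : T * n.-tuple T => [the n.+1.-tuple T of p.1 :: p.2]).
  exact: measurable_cons.
(* One layer of [power_measure] is the pushforward of a product measure under cons. *)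
rewrite (eq_measure_integral (pushforward (mu \x power_measure mu n)%E
    (fun p : T * n.-tuple T => [the n.+1.-tuple T of p.1 :: p.2])))//.
rewrite ge0_integral_pushforward//; last first.
  by move=> t _; rewrite lee_fin prodr_ge0.
rewrite preimage_setT fubini_tonelli1//=; last 2 first.
- exact: (measurableT_comp mF mc).
- by move=> x; rewrite lee_fin prodr_ge0.
rewrite /fubini_F.
have -> : (fun x => \int[power_measure mu n]_y
      (\prod_(k < n.+1) h k (tnth (x :: y) k))%:E)%E =
    (fun x => (h ord0 x)%:E * (\prod_(k < n) I (lift ord0 k))%:E)%E.
  apply/funext => x.
  rewrite -(IHn (fun k => h (lift ord0 k)) (fun k => I (lift ord0 k)))//.
  rewrite -ge0_integralZl_EFin//.
  - apply: eq_integral => y _; rewrite big_ord_recl tnth0 EFinM.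
    by under eq_bigr do rewrite tnthS.
  - by move=> y _; rewrite lee_fin prodr_ge0.
  - by apply/measurable_EFinP; exact: (measurable_prod_tnth (fun k => mh (lift ord0 k))).
rewrite ge0_integralZr//.
- by rewrite hI big_ord_recl EFinM.
- exact/measurable_EFinP.
- by move=> x _; rewrite lee_fin.
- rewrite lee_fin prodr_ge0// => k _; rewrite -lee_fin -hI.
  by apply: integral_ge0 => x _; rewrite lee_fin.
Qed.

Lemma measurable_box d (T : measurableType d) m (B : 'I_m -> set T) :
  (forall k, measurable (B k)) ->
  measurable [set t : m.-tuple T | forall k, B k (tnth t k)].
Proof.
move=> mB.
rewrite (_ : mkset _ = \bigcap_(k in [set: 'I_m]) (@tnth m T ^~ k @^-1` B k)).
  apply: fin_bigcap_measurable => // k _.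
  by rewrite -[X in measurable X]setTI; exact: measurable_tnth.
by apply/seteqP; split => t /= H k; [move=> _|]; exact: H.
Qed.

Lemma power_measure_box d (T : measurableType d) (R : realType)
    (mu : {sigma_finite_measure set T -> \bar R}) m (B : 'I_m -> set T)
    (I : 'I_m -> R) :
  (forall k, measurable (B k)) -> (forall k, mu (B k) = (I k)%:E) ->
  power_measure mu m [set t | forall k, B k (tnth t k)] = (\prod_(k < m) I k)%:E.
Proof.
move=> mB muB.
pose S := [set t : m.-tuple T | forall k, B k (tnth t k)].
transitivity (\int[power_measure mu m]_t (\1_S t)%:E)%E.
  by rewrite integral_indic ?setIT//; exact: measurable_box.
rewrite -(@integral_power_measure _ _ _ mu _ (fun k => \1_(B k))).
- apply: eq_integral => t _; congr (_%:E); rewrite indicE.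
  case: (boolP (t \in _)) => [/set_mem /= H|H].
    by rewrite big1// => k _; rewrite indicE mem_set.
  have /existsNP[k Hk] : ~ (forall k, B k (tnth t k)).
    by move=> H'; move: H; rewrite mem_set.
  by rewrite (bigD1 k)//= indicE memNset// mul0r.
- by move=> k; exact: measurable_indic.
- by move=> k x; rewrite indicE ler0n.
- by move=> k; rewrite integral_indic// setIT; exact: muB.
Qed.

(** With [P] the smaller value, [u + v >= delta] gives [u P + v Q >= delta P], and AM-GM bounds [P]
    from below in terms of the geometric mean [S]. *)
Lemma two_point_pointwise (R : realType) (P Q S b u v delta : R) :
  0 <= P -> 0 <= Q -> 0 <= S -> S ^+ 2 = P * Q -> 0 <= b ->
  0 <= delta -> 0 <= u -> 0 <= v -> delta <= u + v ->
  delta * b * S <= u * P + v * Q + (delta * b ^+ 2 / 4) * (P + Q).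
Proof.
move=> P0 Q0 S0 SPQ b0 d0; wlog PQ : P Q u v P0 Q0 SPQ / P <= Q => [H|] u0 v0 duv.
  have [PQ|/ltW QP] := leP P Q; first exact: H.
  rewrite [u * P + _]addrC [P + Q]addrC; apply: H => //; first by rewrite SPQ mulrC.
  by rewrite addrC.
(* After squaring, the two sides differ by the perfect square [(P - b^2 Q / 4)^2]. *)
have amgm : b * S <= P + b ^+ 2 / 4 * Q.
  rewrite -ler_sqr ?nnegrE ?mulr_ge0//; last first.
    by rewrite addr_ge0// !mulr_ge0// exprn_ge0.
  rewrite exprMn SPQ -subr_ge0.
  rewrite (_ : _ - _ = (P - b ^+ 2 / 4 * Q) ^+ 2); first exact: sqr_ge0.
  by field.
have dP : delta * P <= u * P + v * Q.
  apply: (@le_trans _ _ (u * P + v * P)); first by rewrite -mulrDl ler_wpM2r.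
  by rewrite lerD2l ler_wpM2l.
have c0 : 0 <= delta * b ^+ 2 / 4 * P.
  by rewrite !mulr_ge0// ?exprn_ge0.
rewrite -mulrA; apply: (@le_trans _ _ (delta * (P + b ^+ 2 / 4 * Q))).
  exact: ler_wpM2l.
nra.
Qed.

(* Since [min P Q >= b sqrt (P Q) - (b / 2)^2 (P + Q)] for every [b >= 0], the
   affinity [b] of the two product laws bounds the sum of the risks below. *)
Lemma two_point_affinity d (T : measurableType d) (R : realType)
    (mu : {sigma_finite_measure set T -> \bar R}) (n : nat) (p q : T -> R)
    (u v : n.-tuple T -> R) (delta beta : R) :
  measurable_fun setT p -> measurable_fun setT q ->
  measurable_fun setT u -> measurable_fun setT v ->
  (forall x, 0 <= p x) -> (forall x, 0 <= q x) ->
  (forall t, 0 <= u t) -> (forall t, 0 <= v t) ->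
  (\int[mu]_x (p x)%:E = 1)%E -> (\int[mu]_x (q x)%:E = 1)%E ->
  (\int[mu]_x (Num.sqrt (p x * q x))%:E = beta%:E)%E ->
  0 <= delta -> (forall t, delta <= u t + v t) ->
  ((delta / 2 * beta ^+ n ^+ 2)%:E <=
   \int[power_measure mu n]_t (u t * \prod_(k < n) p (tnth t k))%:E +
   \int[power_measure mu n]_t (v t * \prod_(k < n) q (tnth t k))%:E)%E.
Proof.
move=> mp mq mu_ mv p0 q0 u0 v0 ip iq ib d0 duv.
pose s x := Num.sqrt (p x * q x).
have ms : measurable_fun setT s.
  apply: measurableT_comp; last exact: measurable_funM.
  by apply: continuous_measurable_fun; exact: sqrt_continuous.
have s0 x : 0 <= s x by exact: sqrtr_ge0.
have beta0 : 0 <= beta.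
  by rewrite -lee_fin -ib; apply: integral_ge0 => x _; rewrite lee_fin.
pose P (t : n.-tuple T) := \prod_(k < n) p (tnth t k).
pose Q (t : n.-tuple T) := \prod_(k < n) q (tnth t k).
pose S (t : n.-tuple T) := \prod_(k < n) s (tnth t k).
have mP : measurable_fun setT P by exact: (measurable_prod_tnth (h := fun=> p)).
have mQ : measurable_fun setT Q by exact: (measurable_prod_tnth (h := fun=> q)).
have mS : measurable_fun setT S by exact: (measurable_prod_tnth (h := fun=> s)).
have P0 t : 0 <= P t by exact: prodr_ge0.
have Q0 t : 0 <= Q t by exact: prodr_ge0.
have S0 t : 0 <= S t by exact: prodr_ge0.
have iP : (\int[power_measure mu n]_t (P t)%:E = 1)%E.
  rewrite (integral_power_measure (h := fun=> p) (I := fun=> 1))//.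
  by rewrite prodr_const expr1n.
have iQ : (\int[power_measure mu n]_t (Q t)%:E = 1)%E.
  rewrite (integral_power_measure (h := fun=> q) (I := fun=> 1))//.
  by rewrite prodr_const expr1n.
have iS : (\int[power_measure mu n]_t (S t)%:E = (beta ^+ n)%:E)%E.
  rewrite (integral_power_measure (h := fun=> s) (I := fun=> beta))//.
  by rewrite prodr_const card_ord.
have SPQ t : S t ^+ 2 = P t * Q t.
  rewrite -prodrXl -big_split/=; apply: eq_bigr => k _.
  by rewrite sqr_sqrtr// mulr_ge0.
set b := beta ^+ n in iS *.
have b0 : 0 <= b by exact: exprn_ge0.
have c0 : 0 <= delta * b ^+ 2 / 4 by rewrite !mulr_ge0// exprn_ge0.
(* The pointwise bound is used with its free parameter equal to the integral [b] of [S], which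
   maximises the gain [delta * (b' b - b'^2 / 2)] over [b']. The correction stays on the right,
   since the risks may be infinite. *)
have main : ((delta * b ^+ 2)%:E <=
   \int[power_measure mu n]_t (u t * P t)%:E +
   \int[power_measure mu n]_t (v t * Q t)%:E + (delta * b ^+ 2 / 2)%:E)%E.
  have -> : (delta * b ^+ 2 / 2)%:E = (\int[power_measure mu n]_t
      ((delta * b ^+ 2 / 4)%:E * ((P t)%:E + (Q t)%:E)))%E.
    rewrite ge0_integralZl_EFin//; last 2 first.
    - by move=> t _; rewrite adde_ge0// lee_fin.
    - by apply: emeasurable_funD; exact/measurable_EFinP.
    rewrite ge0_integralD//; try exact/measurable_EFinP;
      try by move=> t _; rewrite lee_fin.
    rewrite [X in (_ * (X + _))%E]iP [X in (_ * (_ + X))%E]iQ -EFinD -EFinM.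
    by congr EFin; field.
  rewrite -ge0_integralD//; last 4 first.
  - by move=> t _; rewrite lee_fin mulr_ge0.
  - by apply/measurable_EFinP; exact: measurable_funM.
  - by move=> t _; rewrite lee_fin mulr_ge0.
  - by apply/measurable_EFinP; exact: measurable_funM.
  rewrite -ge0_integralD//; last 4 first.
  - by move=> t _; rewrite -EFinD lee_fin addr_ge0// mulr_ge0.
  - by apply: emeasurable_funD; apply/measurable_EFinP; exact: measurable_funM.
  - by move=> t _; rewrite -EFinD -EFinM lee_fin mulr_ge0// addr_ge0.
  - apply/measurable_EFinP; apply: measurable_funM => //.
    exact: measurable_funD.
  have -> : (delta * b ^+ 2)%:E =
      (\int[power_measure mu n]_t ((delta * b)%:E * (S t)%:E))%E.
    rewrite ge0_integralZl_EFin ?mulr_ge0//; last 2 first.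
    - by move=> t _; rewrite lee_fin.
    - exact/measurable_EFinP.
    by rewrite [X in (_ * X)%E]iS -EFinM expr2 mulrA.
  apply: le_integral_ge0 => t _; rewrite -?EFinD -?EFinM lee_fin ?mulr_ge0//.
  exact: two_point_pointwise.
rewrite -(@leeD2rE _ (delta * b ^+ 2 / 2)%:E)//; apply: le_trans main.
by rewrite -EFinD lee_fin le_eqVlt; apply/orP; left; apply/eqP; field.
Qed.

(** One minus the affinity is half the integral of [(sqrt p - sqrt q)^2]. The hypotheses say that
    the square roots agree up to a factor [1 - eps], so this integrand is at most [4 eps^2 p]. *)
Lemma affinity_lower_bound d (T : measurableType d) (R : realType)
    (mu : {measure set T -> \bar R}) (p q : T -> R) (eps : R) :
  measurable_fun setT p -> measurable_fun setT q ->
  (forall x, 0 <= p x) -> (forall x, 0 <= q x) ->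
  (\int[mu]_x (p x)%:E = 1)%E -> (\int[mu]_x (q x)%:E = 1)%E ->
  0 <= eps <= 2^-1 ->
  (forall x, (1 - eps) ^+ 2 * p x <= q x) ->
  (forall x, (1 - eps) ^+ 2 * q x <= p x) ->
  ((1 - 2 * eps ^+ 2)%:E <= \int[mu]_x (Num.sqrt (p x * q x))%:E)%E.
Proof.
move=> mp mq p0 q0 ip iq /andP[e0 e1] pq qp.
have ms : measurable_fun setT (fun x => Num.sqrt (p x * q x)).
  apply: measurableT_comp; last exact: measurable_funM.
  by apply: continuous_measurable_fun; exact: sqrt_continuous.
have main : (1 <= \int[mu]_x (Num.sqrt (p x * q x))%:E + (2 * eps ^+ 2)%:E)%E.
  have -> : (2 * eps ^+ 2)%:E = (\int[mu]_x ((2 * eps ^+ 2)%:E * (p x)%:E))%E.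
    rewrite ge0_integralZl_EFin ?ip ?mule1 ?mulr_ge0 ?exprn_ge0//.
    - by move=> x _; rewrite lee_fin.
    - exact/measurable_EFinP.
  rewrite -ge0_integralD//; last 3 first.
  - exact/measurable_EFinP.
  - by move=> x _; rewrite lee_fin !mulr_ge0// exprn_ge0.
  - by apply/measurable_EFinP; exact: measurable_funM.
  have -> : (1 = \int[mu]_x ((2^-1)%:E * ((p x)%:E + (q x)%:E)))%E.
    rewrite ge0_integralZl_EFin//; last 2 first.
    - by move=> x _; rewrite adde_ge0// lee_fin.
    - by apply: emeasurable_funD; exact/measurable_EFinP.
    rewrite ge0_integralD//; try exact/measurable_EFinP;
      try by move=> t _; rewrite lee_fin.
    by rewrite ip iq -EFinD -EFinM; congr EFin; field.
  apply: le_integral_ge0 => x _; rewrite -?EFinD -?EFinM lee_fin.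
    by rewrite mulr_ge0// addr_ge0.
  rewrite sqrtrM//; move: (pq x) (qp x).
  have [a [b [a0 b0 -> ->]]] : exists a b, [/\ 0 <= a, 0 <= b, p x = a ^+ 2 & q x = b ^+ 2].
    by exists (Num.sqrt (p x)), (Num.sqrt (q x)); rewrite !sqr_sqrtr.
  rewrite !sqrtr_sqr !ger0_norm//.
  have oe : 0 <= 1 - eps by lra.
  rewrite -!exprMn !ler_sqr ?nnegrE ?mulr_ge0// => ab ba.
  have ea : 0 <= eps * a by exact: mulr_ge0.
  have eea : 0 <= eps * (2^-1 - eps) * a by rewrite !mulr_ge0// subr_ge0.
  have oe' : 0 < 1 - eps by lra.
  (* This is [1 / (1 - eps) - 1 <= 2 eps], valid for [eps <= 1/2]; the slack is the term [eea]. *)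
  have h1 : b - a <= 2 * eps * a.
    by rewrite -(ler_pM2l oe'); lra.
  have h2 : a - b <= 2 * eps * a by lra.
  have h3 : (b - a) ^+ 2 <= (2 * eps * a) ^+ 2.
    rewrite -real_normK ?num_real// ler_sqr ?nnegrE ?mulr_ge0// ler_norml.
    by apply/andP; split; lra.
  nra.
rewrite -(@leeD2rE _ (2 * eps ^+ 2)%:E)//; apply: le_trans main.
by rewrite -EFinD lee_fin subrK.
Qed.

Lemma bernoulli_ineq (R : realType) (x : R) n : 0 <= x <= 1 -> 1 - n%:R * x <= (1 - x) ^+ n.
Proof.
move=> /andP[x0 x1]; elim: n => [|n IHn]; first by rewrite mul0r subr0 expr0.
rewrite exprS; apply: (@le_trans _ _ ((1 - x) * (1 - n%:R * x))); last first.
  by rewrite ler_wpM2l// subr_ge0.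
have : 0 <= n%:R * x * x by rewrite !mulr_ge0.
rewrite -natr1; nra.
Qed.

(** By Bernoulli, the affinity of the product laws is at least [1 - 2 n eps^2 >= 1/2], and
    [delta / 2 * (1/2)^2] is the announced [delta / 8]. *)
Lemma two_point_bound d (T : measurableType d) (R : realType)
    (mu : {sigma_finite_measure set T -> \bar R}) (n : nat) (p q : T -> R)
    (u v : n.-tuple T -> R) (delta eps : R) :
  measurable_fun setT p -> measurable_fun setT q ->
  measurable_fun setT u -> measurable_fun setT v ->
  (forall x, 0 <= p x) -> (forall x, 0 <= q x) ->
  (forall t, 0 <= u t) -> (forall t, 0 <= v t) ->
  (\int[mu]_x (p x)%:E = 1)%E -> (\int[mu]_x (q x)%:E = 1)%E ->
  0 <= eps <= 2^-1 -> n%:R * eps ^+ 2 <= 4^-1 ->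
  (forall x, (1 - eps) ^+ 2 * p x <= q x) ->
  (forall x, (1 - eps) ^+ 2 * q x <= p x) ->
  0 <= delta -> (forall t, delta <= u t + v t) ->
  ((delta / 8)%:E <=
   \int[power_measure mu n]_t (u t * \prod_(k < n) p (tnth t k))%:E +
   \int[power_measure mu n]_t (v t * \prod_(k < n) q (tnth t k))%:E)%E.
Proof.
move=> mp mq mu_ mv p0 q0 u0 v0 ip iq e01 ne pq qp d0 duv.
have := affinity_lower_bound mp mq p0 q0 ip iq e01 pq qp.
have /andP[e0 e1] := e01.
(* The affinity is finite because [sqrt (p q) <= p + q]. *)
have fin_b : (\int[mu]_x (Num.sqrt (p x * q x))%:E)%E \is a fin_num.
  rewrite ge0_fin_numE; last by apply: integral_ge0 => x _; rewrite lee_fin.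
  apply: (@le_lt_trans _ _ (\int[mu]_x ((p x)%:E + (q x)%:E))%E).
    apply: le_integral_ge0 => x _; rewrite -?EFinD lee_fin//.
    rewrite -ler_sqr ?nnegrE ?addr_ge0// sqr_sqrtr ?mulr_ge0//.
    by have := p0 x; have := q0 x; nra.
  rewrite ge0_integralD//; try exact/measurable_EFinP;
    try by move=> t _; rewrite lee_fin.
  by rewrite ip iq -EFinD ltry.
rewrite -(fineK fin_b) lee_fin => bb.
have := two_point_affinity mp mq mu_ mv p0 q0 u0 v0 ip iq (esym (fineK fin_b)) d0 duv.
apply: le_trans; rewrite lee_fin.
set beta := fine _ in bb *.
have sq : eps ^+ 2 <= 4^-1 by nra.
have bn : 2^-1 <= beta ^+ n.
  apply: (@le_trans _ _ ((1 - 2 * eps ^+ 2) ^+ n)); last first.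
    by rewrite lerXn2r ?nnegrE//; lra.
  have /(bernoulli_ineq n) : 0 <= 2 * eps ^+ 2 <= 1.
    by have := sqr_ge0 eps; move=> ?; apply/andP; split; lra.
  by apply: le_trans; nra.
have -> : delta / 8 = delta / 2 * 2^-1 ^+ 2 by field.
by rewrite ler_wpM2l ?divr_ge0// lerXn2r ?nnegrE//; lra.
Qed.

(** * The length of curves *)

Lemma derive1_compE (R : realType) (V W : normedModType R) (f : R -> V)
    (F : V -> W) (t : R) : derivable f t 1 -> differentiable F (f t) ->
  derivable (F \o f) t 1 /\ derive1 (F \o f) t = 'D_(derive1 f t) F (f t).
Proof.
move=> /derivable1_diffP df dF.
have dFf : differentiable (F \o f) t by exact: differentiable_comp.
split; first exact/derivable1_diffP.
by rewrite derive1E'// diff_comp//= -derive1E'// deriveE.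
Qed.

Lemma near_eq_derive1 (R : realType) (V : normedModType R) (f g : R -> V) t :
  {near t, f =1 g} -> derive1 f t = derive1 g t.
Proof. by move=> fg; rewrite !derive1E; exact: near_eq_derive. Qed.

Definition qform (R : realType) m (G : 'M[R]_m) (v : 'rV[R]_m) : R :=
  (v *m G *m v^T) 0 0.

Lemma qformE (R : realType) m (G : 'M[R]_m) v :
  qform G v = \sum_j \sum_k v 0 k * G k j * v 0 j.
Proof.
rewrite /qform mxE; apply: eq_bigr => j _; rewrite !mxE mulr_suml.
by apply: eq_bigr => k _.
Qed.

Lemma cvg_qform (R : realType) m (T : Type) (F : set_system T) (FF : Filter F)
    (G : T -> 'M[R]_m) (v : T -> 'rV[R]_m) G0 v0 :
  G @ F --> G0 -> v @ F --> v0 -> qform (G x) (v x) @[x --> F] --> qform G0 v0.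
Proof.
move=> cG cv; rewrite qformE; under eq_cvg do rewrite qformE.
have cvk k : v x 0 k @[x --> F] --> v0 0 k.
  exact: (cvg_comp _ _ cv (@matrix_normedtype.coord_continuous _ _ _ 0 k v0)).
have cGk k j : G x k j @[x --> F] --> G0 k j.
  exact: (cvg_comp _ _ cG (@matrix_normedtype.coord_continuous _ _ _ k j G0)).
apply: cvg_big => [|j _]; first exact: add_continuous.
apply: cvg_big => [|k _]; first exact: add_continuous.
by apply: cvgM => //; apply: cvgM.
Qed.

Lemma qform_bound (R : realType) m (G : 'M[R]_m) (v : 'rV[R]_m) K r :
  (forall k j, `|G k j| <= K) -> (forall k, `|v 0 k| <= r) ->
  `|qform G v| <= K * (m%:R * r) ^+ 2.
Proof.
move=> GK vr; case: m G v GK vr => [|m] G v GK vr.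
  rewrite qformE big_ord0 normr0 mul0r expr0n mulr0 //.
have K0 : 0 <= K by exact: le_trans (normr_ge0 _) (GK ord0 ord0).
have r0 : 0 <= r by exact: le_trans (normr_ge0 _) (vr ord0).
rewrite qformE; apply: le_trans (ler_norm_sum _ _ _) _.
apply: (@le_trans _ _ (\sum_(j < m.+1) \sum_(k < m.+1) K * r ^+ 2)); last first.
  by rewrite !sumr_const card_ord -mulrnA mulnn exprMn -natrX mulr_natl mulrnAr.
apply: ler_sum => j _; apply: le_trans (ler_norm_sum _ _ _) _.
apply: ler_sum => k _; rewrite !normrM expr2 mulrCA -mulrA.
by rewrite ler_pM// ?mulr_ge0// ler_pM.
Qed.

Section curves.
Context (R : realType) (m : nat) (M : topologicalType).
Variables (A : smooth_atlas R m M) (g : riemannian_metric A).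
Implicit Types (i j : chart A) (c : R -> M).

Local Notation crd := (@Defs.coord R m M A).
Local Notation par := (@param R m M A).

Lemma image_coord i x : dom i x -> (crd i @` dom i) (crd i x).
Proof. by move=> ?; exists x. Qed.

Lemma param_dom i y : (crd i @` dom i) y -> dom i (par i y).
Proof. by move=> [x dx <-]; rewrite coordK. Qed.

Lemma paramK i y : (crd i @` dom i) y -> crd i (par i y) = y.
Proof. by move=> [x dx <-]; rewrite coordK. Qed.

Lemma transition_diff i j x : dom i x -> dom j x ->
  differentiable (crd j \o par i) (crd i x).
Proof.
by move=> ix jx; have [h _] := transition_smooth i j 1; apply: h; exists x.
Qed.

Lemma near_curve_dom c t i : {for t, continuous c} -> dom i (c t) ->
  \forall s \near t, dom i (c s).
Proof. by move=> cc di; apply: cc; apply: open_nbhs_nbhs; split=> //; exact: dom_open. Qed.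

Lemma near_transition c t i j : {for t, continuous c} -> dom i (c t) ->
  {near t, crd j \o c =1 (crd j \o par i) \o (crd i \o c)}.
Proof.
move=> cc di; have := near_curve_dom cc di.
by apply: filterS => s ds /=; rewrite coordK.
Qed.

Lemma derive1_transition c t i j : {for t, continuous c} ->
  dom i (c t) -> dom j (c t) -> derivable (crd i \o c) t 1 ->
  derivable (crd j \o c) t 1 /\
  derive1 (crd j \o c) t =
    derive1 (crd i \o c) t *m 'J (crd j \o par i) (crd i (c t)).
Proof.
move=> cc di dj dci.
have tr := near_transition j cc di.
have dtr := transition_diff di dj.
have [h1 h2] := derive1_compE dci dtr.
split.
  by apply: near_eq_derivable h1; apply: filterS tr.
by rewrite (near_eq_derive1 tr) h2 deriveEjacobian.
Qed.

(** [speed] changes chart with the point of the curve. Continuity and derivatives have to be read in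
    a fixed chart [i]. *)
Definition chart_speed i c t : R :=
  Num.sqrt (qform (gram g i (crd i (c t))) (derive1 (crd i \o c) t)).

(** The Jacobians produced by the change of velocity are absorbed by [gram_transition]. *)
Lemma speed_chart c t i : {for t, continuous c} -> dom i (c t) ->
  derivable (crd i \o c) t 1 -> speed g c t = chart_speed i c t.
Proof.
move=> cc di dci; rewrite /speed /chart_speed.
set j := chart_at A (c t); have dj : dom j (c t) by exact: dom_chart_at.
have [_ ->] := derive1_transition cc di dj dci.
rewrite (@gram_transition _ _ _ _ g i j (crd i (c t))); last by exists (c t) => //; split.
by rewrite /= coordK// /qform trmx_mul !mulmxA.
Qed.

Lemma speed_ge0 c t : 0 <= speed g c t. Proof. exact: sqrtr_ge0. Qed.

Lemma itv01P (t : R) : [set` `[0%R, 1%R]] t <-> 0 <= t <= 1.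
Proof. by rewrite /= in_itv. Qed.

Lemma chart_speed_cvg c t i : {for t, continuous c} -> dom i (c t) ->
  {for t, continuous (derive1 (crd i \o c))} ->
  {for t, continuous (chart_speed i c)}.
Proof.
move=> cc di dc; apply: continuous_cvg; first exact: sqrt_continuous.
apply: cvg_qform => //.
have ci : crd i (c s) @[s --> t] --> crd i (c t).
  by apply: continuous_comp => //; exact: Defs.coord_continuous.
have cg : {for crd i (c t), continuous (gram g i)}.
  by have := gram_smooth g i 0; apply; exact: image_coord.
exact: (cvg_comp _ _ ci cg).
Qed.

Lemma speed_continuous c : C1_curve A c ->
  {within `[0, 1], continuous (speed g c)}.
Proof.
move=> cC; apply/subspace_continuousP => t /itv01P t01.
have [ct di] := cC _ t01; set i := chart_at A (c t).
have dt : dom i (c t) by exact: dom_chart_at.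
have [dn dc] := di _ dt.
have st : speed g c t = chart_speed i c t.
  exact: (speed_chart ct dt (nbhs_singleton dn)).
(* The restriction to [[0, 1]] matters: [C1_curve] gives continuity of [c] only at those times. *)
have nE : {near within `[0, 1] (nbhs t), chart_speed i c =1 speed g c}.
  rewrite near_withinE; apply: filterS2 dn (near_curve_dom ct dt) => s ds doms.
  by move=> /itv01P s01; exact: (esym (speed_chart (cC _ s01).1 doms ds)).
have cvgs : chart_speed i c s @[s --> within [set` `[0, 1]] (nbhs t)] --> speed g c t.
  by rewrite st; apply: cvg_within_filter; exact: chart_speed_cvg.
exact: (cvg_trans (near_eq_cvg nE) cvgs).
Qed.

Lemma speed_integrable c : C1_curve A c ->
  lebesgue_measure.-integrable `[0%R, 1%R] (EFin \o speed g c).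
Proof.
move=> cC; apply: continuous_compact_integrable; first exact: segment_compact.
exact: speed_continuous.
Qed.

Lemma C1_length_ge0 c : 0 <= C1_length g c.
Proof. by apply: Rintegral_ge0 => t _; exact: speed_ge0. Qed.

Lemma onem_continuous : continuous (fun t : R => 1 - t).
Proof. by move=> t; apply: cvgB; [exact: cvg_cst|exact: cvg_id]. Qed.

Lemma near_onem (P : R -> Prop) (t : R) : (\forall s \near (1 - t), P s) ->
  \forall s \near t, P (1 - s).
Proof. by move=> nP; exact: (@onem_continuous t _ nP). Qed.

Lemma derive1_rev (V : normedModType R) (f : R -> V) t :
  derivable f (1 - t) 1 -> derivable (fun s : R => f (1 - s)) t 1 /\
  derive1 (fun s : R => f (1 - s)) t = - derive1 f (1 - t).
Proof.
move=> df.
have d1 : is_derive t 1 (fun s : R => 1 - s) (-1).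
  have := is_deriveB (is_derive_cst (1 : R) t 1) (is_derive_id t 1).
  by rewrite sub0r.
have d1' : derivable (fun s : R => 1 - s) t 1 by exact: (@ex_derive _ _ _ _ _ _ _ d1).
have [h1 h2] := derive1_compE d1' ((derivable1_diffP _ _).1 df).
split=> //; rewrite h2 derive1E derive_val deriveE; last exact/derivable1_diffP.
by rewrite linearN -derive1E'//; exact/derivable1_diffP.
Qed.

Definition rev_curve c t := c (1 - t).

Lemma rev_01 (t : R) : 0 <= t <= 1 -> 0 <= 1 - t <= 1.
Proof. by move=> /andP[? ?]; apply/andP; split; lra. Qed.

Lemma C1_rev c : C1_curve A c -> C1_curve A (rev_curve c).
Proof.
move=> cC t t01; have [ct di] := cC _ (rev_01 t01).
split; first by apply: continuous_comp => //; exact: onem_continuous.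
move=> i /di [dn dc].
have dn' : \forall s \near t, derivable (crd i \o c) (1 - s) 1.
  exact: (near_onem (P := fun s => derivable (crd i \o c) s 1) dn).
have nE : {near t, (fun s : R => - derive1 (crd i \o c) (1 - s)) =1
                   derive1 (crd i \o rev_curve c)}.
  by apply: filterS dn' => s ds; have [_ <-] := derive1_rev ds.
split; first by apply: filterS dn' => s ds; have [] := derive1_rev ds.
have cv : - derive1 (crd i \o c) (1 - s) @[s --> t] -->
    derive1 (crd i \o rev_curve c) t.
  rewrite -(nbhs_singleton nE); apply: cvgN.
  exact: (cvg_comp _ _ (@onem_continuous t) dc).
exact: (cvg_trans (near_eq_cvg nE) cv).
Qed.

Lemma qformN (G : 'M[R]_m) v : qform G (- v) = qform G v.
Proof. by rewrite /qform linearN/= mulNmx mulmxN mulNmx opprK. Qed.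

Lemma speed_rev c t : C1_curve A c -> 0 <= t <= 1 ->
  speed g (rev_curve c) t = speed g c (1 - t).
Proof.
move=> cC t01; have [ct di] := cC _ (rev_01 t01).
pose i := chart_at A (c (1 - t)); have [dn _] := di i (dom_chart_at A (c (1 - t))).
have e : derive1 (crd i \o rev_curve c) t = - derive1 (crd i \o c) (1 - t).
  exact: (derive1_rev (nbhs_singleton dn)).2.
change (chart_speed i (rev_curve c) t = chart_speed i c (1 - t)).
rewrite /chart_speed e qformN; reflexivity.
Qed.

Lemma C1_length_rev c : C1_curve A c -> C1_length g (rev_curve c) = C1_length g c.
Proof.
move=> cC; have i01 : 0 <= (1 : R) <= 1 by apply/andP; split.
have e := Rintegration_by_substitution_onem i01 (speed_continuous cC).
rewrite /C1_length [RHS]e unstable.onem1.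
by apply: eq_Rintegral => t /set_mem/itv01P t01; exact: speed_rev.
Qed.

Lemma piecewise_C1_ge0 x y L : piecewise_C1 g x y L -> 0 <= L.
Proof. by elim=> // *; rewrite addr_ge0// C1_length_ge0. Qed.

Lemma piecewise_C1_cat x y z L L' : piecewise_C1 g x y L ->
  piecewise_C1 g y z L' -> piecewise_C1 g x z (L + L').
Proof.
move=> xy; elim: xy z L' => [w|c w K cC _ IH] z L' yz; first by rewrite add0r.
by rewrite -addrA; apply: piecewise_C1_cons => //; exact: IH.
Qed.

Lemma piecewise_C1_curve c : C1_curve A c ->
  piecewise_C1 g (c 0) (c 1) (C1_length g c).
Proof.
move=> cC; rewrite -[X in piecewise_C1 _ _ _ X]addr0.
by apply: piecewise_C1_cons => //; exact: piecewise_C1_nil.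
Qed.

Lemma piecewise_C1_sym x y L : piecewise_C1 g x y L -> piecewise_C1 g y x L.
Proof.
elim=> [w|c w K cC _ IH]; first exact: piecewise_C1_nil.
rewrite addrC; apply: piecewise_C1_cat IH _.
have := piecewise_C1_curve (C1_rev cC).
by rewrite C1_length_rev// /rev_curve subrr subr0.
Qed.

End curves.

(** * Straight segments inside a chart *)

Lemma entry_le_norm (R : realType) m n (G : 'M[R]_(m, n)) i j :
  `|G i j| <= `|G|.
Proof.
rewrite [leRHS]mx_normrE.
exact: (@le_bigmax_cond _ _ _ _ (i, j) xpredT (fun ij => `|G ij.1 ij.2|)).
Qed.

Lemma qform_norm (R : realType) m (G : 'M[R]_m) (v : 'rV[R]_m) :
  `|qform G v| <= `|G| * (m%:R * `|v|) ^+ 2.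
Proof. by apply: qform_bound => *; exact: entry_le_norm. Qed.

Section line.
Context (R : realType) (V : normedModType R) (y v : V).

Definition line (t : R) : V := y + t *: v.

Lemma line_derive t : derivable line t 1 /\ derive1 line t = v.
Proof.
have did : differentiable (id : R -> R) t.
  by apply/derivable1_diffP; exact: derivable_id.
have d1 : differentiable (fun z : R => z *: v) t by exact: differentiableZl.
have dl : differentiable line t.
  by apply: differentiableD => //; exact: differentiable_cst.
split; first exact/derivable1_diffP.
rewrite derive1E'// diffD// diff_cst diffZl//.
rewrite [LHS](_ : _ = 0 + 'd (id : R -> R) t 1 *: v)// add0r.
by rewrite -(derive1E' did) derive1_id scale1r.
Qed.

Lemma line_continuous : continuous line.
Proof.
move=> t; apply: differentiable_continuous.
by apply/derivable1_diffP; exact: (line_derive t).1.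
Qed.

End line.

Lemma near_quad_le (R : realType) (V : normedModType R) (y : V) (K c e : R) :
  0 < e -> \forall z \near y, K * (c * `|z - y|) ^+ 2 <= e.
Proof.
move=> e0.
have c1 : c * `|z - y| @[z --> y] --> c * `|y - y|.
  apply: cvgM; first exact: cvg_cst.
  by apply: cvg_norm; apply: cvgB; [exact: cvg_id|exact: cvg_cst].
have cv : K * (c * `|z - y|) ^+ 2 @[z --> y] --> K * (c * `|y - y|) ^+ 2.
  apply: cvgM; first exact: cvg_cst.
  exact: (cvg_comp _ _ c1 (@exprn_continuous _ 2 _)).
rewrite subrr normr0 mulr0 expr0n mulr0 in cv.
move: cv => /cvgrPdist_le/(_ _ e0).
by apply: filterS => z; rewrite sub0r normrN; apply: le_trans; exact: ler_norm.
Qed.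

Section local_bound.
Context (R : realType) (m : nat) (M : topologicalType).
Variables (A : smooth_atlas R m M) (g : riemannian_metric A).
Implicit Types (i j : chart A).

Local Notation crd := (@Defs.coord R m M A).
Local Notation par := (@param R m M A).

Lemma chart_line_C1 i y v :
  (forall t, 0 <= t <= 1 -> (crd i @` dom i) (line y v t)) ->
  C1_curve A (par i \o line y v).
Proof.
move=> yU t t01; have Ut := yU _ t01.
have lt : {for t, continuous (line y v)} by exact: line_continuous.
have ct : {for t, continuous (par i \o line y v)}.
  by apply: continuous_comp => //; exact: param_continuous.
have nU : \forall s \near t, (crd i @` dom i) (line y v s).
  by apply: lt; apply: open_nbhs_nbhs; split=> //; exact: image_open.
split=> // j dj.
have ns : \forall s \near t, (crd i @` (dom i `&` dom j)) (line y v s).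
  apply: filterS2 nU (near_curve_dom ct dj) => s Us djs.
  exists (par i (line y v s)); last exact: paramK.
  by split=> //; exact: param_dom.
have [dF cF] := transition_smooth i j 1.
have h s : (crd i @` (dom i `&` dom j)) (line y v s) ->
    derivable (crd j \o (par i \o line y v)) s 1 /\
    'D_v (crd j \o par i) (line y v s) = derive1 (crd j \o (par i \o line y v)) s.
  move=> sU; have [ds es] := line_derive y v s.
  have [h1 h2] := derive1_compE ds (dF _ sU); split; first exact: h1.
  by rewrite h2 es.
split; first by apply: filterS ns => s /h[].
have nE : {near t, (fun s => 'D_v (crd j \o par i) (line y v s)) =1
    derive1 (crd j \o (par i \o line y v))}.
  by apply: filterS ns => s /h[].
have cv : 'D_v (crd j \o par i) (line y v s) @[s --> t] -->
    derive1 (crd j \o (par i \o line y v)) t.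
  rewrite -(nbhs_singleton nE).
  exact: (cvg_comp _ _ lt (cF v _ (nbhs_singleton ns))).
exact: (cvg_trans (near_eq_cvg nE) cv).
Qed.

Lemma chart_line_speed i y v t : (crd i @` dom i) (line y v t) ->
  speed g (par i \o line y v) t = Num.sqrt (qform (gram g i (line y v t)) v).
Proof.
move=> Ut.
have lt : {for t, continuous (line y v)} by exact: line_continuous.
have ct : {for t, continuous (par i \o line y v)}.
  by apply: continuous_comp => //; exact: param_continuous.
have nU : \forall s \near t, (crd i @` dom i) (line y v s).
  by apply: lt; apply: open_nbhs_nbhs; split=> //; exact: image_open.
have nE : {near t, line y v =1 crd i \o (par i \o line y v)}.
  by apply: filterS nU => s Us /=; rewrite paramK.
have [dl el] := line_derive y v t.
have dt : derivable (crd i \o (par i \o line y v)) t 1.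
  exact: near_eq_derivable nE dl.
rewrite (speed_chart g ct (param_dom Ut) dt) /chart_speed.
by rewrite -(near_eq_derive1 nE) el /= paramK.
Qed.

Lemma C1_length_le c e : 0 <= e -> C1_curve A c ->
  (forall t, 0 <= t <= 1 -> speed g c t <= e) -> C1_length g c <= e.
Proof.
move=> e0 cC ce; rewrite /C1_length /Rintegral.
have ie : (\int[lebesgue_measure]_(t in [set` `[0%R, 1%R]]) (cst e%:E) t = e%:E)%E.
  by rewrite integral_cst//= lebesgue_measure_itv/= lte_fin ltr01 sube0 mule1.
have H : (\int[lebesgue_measure]_(t in [set` `[0%R, 1%R]]) (speed g c t)%:E <= e%:E)%E.
  rewrite -ie; apply: le_integral_ge0 => t /itv01P t01.
    by rewrite lee_fin speed_ge0.
  by rewrite /= lee_fin ce.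
rewrite -lee_fin fineK// ge0_fin_numE ?(le_lt_trans H (ltry _))//.
by apply: integral_ge0 => t _; rewrite lee_fin speed_ge0.
Qed.

(** Near [x] the Gram matrix is bounded by [K], so the chart segment with displacement [v] has
    length at most [sqrt K * m * |v|]. Both the openness of reachable sets and the continuity of the
    distance come from this. *)
Lemma near_piecewise_C1 x e : 0 < e ->
  \forall y \near x, exists2 L, piecewise_C1 g x y L & L <= e.
Proof.
move=> e0; pose i := chart_at A x; have dx : dom i x by exact: dom_chart_at.
pose y0 := crd i x; have Uy0 : (crd i @` dom i) y0 by exact: image_coord.
have cg : {for y0, continuous (gram g i)} by exact: (gram_smooth g i 0).
pose K := `|gram g i y0| + 1.
have nG : \forall z \near y0, `|gram g i z| <= K.
  have cn : `|gram g i z| @[z --> y0] --> `|gram g i y0|.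
    by apply: cvg_norm; [exact: nbhs_filter|exact: cg].
  move/cvgrPdist_le : cn => /(_ _ ltr01); apply: filterS => z.
  by rewrite /K ler_norml => /andP[]; lra.
have nU : \forall z \near y0, (crd i @` dom i) z.
  by apply: open_nbhs_nbhs; split=> //; exact: image_open.
have [r /= r0 rB] := (nbhs_ballP _ _).1 (filterI nG nU).
have n1 := near_quad_le y0 K m%:R (exprn_gt0 2 e0).
have n2 := nbhsx_ballx y0 r r0.
have ny : \forall y \near x, dom i y.
  by apply: open_nbhs_nbhs; split=> //; exact: dom_open.
have ccx := Defs.coord_continuous dx.
apply: filterS3 ny (ccx _ n1) (ccx _ n2) => y dy ey ry.
pose v := crd i y - y0.
(* Balls are convex, so the whole segment stays where the chart and the bound [K] are available. *)
have B t : 0 <= t <= 1 -> ball y0 r (line y0 v t).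
  move=> /andP[t0 t1]; move: ry; rewrite -!ball_normE/=.
  rewrite /line opprD addrA subrr sub0r normrN normrZ -normrN opprB => rv.
  apply: le_lt_trans rv; rewrite ger0_norm//.
  by rewrite /v -[leRHS]mul1r ler_wpM2r// -normrN opprB.
have cC : C1_curve A (par i \o line y0 v).
  by apply: chart_line_C1 => t t01; have [] := rB _ (B _ t01).
exists (C1_length g (par i \o line y0 v)).
  have := piecewise_C1_curve g cC.
  by rewrite /= /line scale0r addr0 scale1r /v [y0 + _]addrC subrK !coordK.
apply: C1_length_le => // [|t t01]; first exact: ltW.
have [Kt Ut] := rB _ (B _ t01); rewrite chart_line_speed//.
rewrite -[leRHS]ger0_norm ?(ltW e0)// -sqrtr_sqr ler_sqrt ?exprn_ge0 ?(ltW e0)//.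
apply: le_trans (ler_norm _) _; apply: le_trans (qform_norm _ _) _.
by apply: le_trans ey; rewrite ler_wpM2r// exprn_ge0// mulr_ge0.
Qed.

End local_bound.

(** * The geodesic distance *)

Section distance.
Context (R : realType) (m : nat) (M : topologicalType).
Variables (A : smooth_atlas R m M) (g : riemannian_metric A).
Hypothesis path_connected : forall x y : M, exists c : R -> M,
  [/\ {within `[0, 1], continuous c}, c 0 = x & c 1 = y].

Local Notation d := (geodesic_dist g).

(** The set of points reachable from [x] is open and closed, so it contains every continuous path
    from [x]. This makes the infimum in [geodesic_dist] range over a nonempty set instead of taking
    a default value. *)
Lemma piecewise_C1_connected x y : exists L, piecewise_C1 g x y L.
Proof.
pose S := [set z | exists L, piecewise_C1 g x z L].
have oS : open S.
  rewrite openE => z [L xz]; rewrite /interior /=.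
  apply: filterS (near_piecewise_C1 g z ltr01) => w [L' zw _].
  by exists (L + L'); exact: piecewise_C1_cat xz zw.
have cS : closed S.
  rewrite -[S]setCK; apply: open_closedC; rewrite openE => z nz.
  apply: filterS (near_piecewise_C1 g z ltr01) => w [L' zw _] [L xw].
  by apply: nz; exists (L + L'); exact: (piecewise_C1_cat xw (piecewise_C1_sym zw)).
have [c [cc c0 c1]] := path_connected x y.
have cA : connected (c @` [set` `[0, 1]]).
  by apply: connected_continuous_connected => //; exact: segment_connected.
have E : c @` [set` `[0, 1]] `&` S = c @` [set` `[0, 1]].
  apply: cA; [|by exists S|by exists S].
  exists x; split; first by exists 0 => //; apply/itv01P; rewrite lexx ler01.
  by exists 0; exact: piecewise_C1_nil.
have : (c @` [set` `[0, 1]] `&` S) y.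
  by rewrite E; exists 1 => //; apply/itv01P; rewrite lexx ler01.
by case.
Qed.

Lemma has_inf_piecewise_C1 x y : has_inf [set L | piecewise_C1 g x y L].
Proof.
split; first exact: piecewise_C1_connected.
by exists 0 => L; exact: piecewise_C1_ge0.
Qed.

Lemma geodesic_dist_ge0 x y : 0 <= d x y.
Proof.
apply: lb_le_inf; first exact: (has_inf_piecewise_C1 x y).1.
by move=> L; exact: piecewise_C1_ge0.
Qed.

Lemma geodesic_dist_le x y L : piecewise_C1 g x y L -> d x y <= L.
Proof. by move=> xy; apply: ge_inf => //; exact: (has_inf_piecewise_C1 x y).2. Qed.

Lemma geodesic_dist_adherent x y e : 0 < e ->
  exists2 L, piecewise_C1 g x y L & L < d x y + e.
Proof. by move=> e0; exact: inf_adherent e0 (has_inf_piecewise_C1 x y). Qed.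

Lemma geodesic_distxx x : d x x = 0.
Proof.
apply/eqP; rewrite eq_le geodesic_dist_ge0 andbT.
by apply: geodesic_dist_le; exact: piecewise_C1_nil.
Qed.

Lemma geodesic_dist_triangle y x z : d x z <= d x y + d y z.
Proof.
apply/ler_addgt0Pr => e e0; have e2 : 0 < e / 2 by rewrite divr_gt0.
have [L xy Ll] := geodesic_dist_adherent x y e2.
have [L' yz Ll'] := geodesic_dist_adherent y z e2.
have := geodesic_dist_le (piecewise_C1_cat xy yz); lra.
Qed.

Lemma geodesic_dist_sym x y : d x y = d y x.
Proof.
have H u v : d u v <= d v u.
  apply/ler_addgt0Pr => e e0; have [L vu Ll] := geodesic_dist_adherent v u e0.
  by have := geodesic_dist_le (piecewise_C1_sym vu); lra.
by apply/eqP; rewrite eq_le !H.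
Qed.

Lemma geodesic_dist_lip x y z : `|d x z - d y z| <= d x y.
Proof.
rewrite ler_norml; have := geodesic_dist_triangle y x z.
have := geodesic_dist_triangle x y z; rewrite (geodesic_dist_sym y x).
by move=> ? ?; apply/andP; split; lra.
Qed.

Lemma geodesic_dist_continuous z : continuous (fun x => d x z).
Proof.
move=> x; apply/cvgrPdist_le => e e0.
apply: filterS (near_piecewise_C1 g x e0) => y [L xy Le].
by apply: le_trans (geodesic_dist_lip _ _ _) _; apply: le_trans Le; exact: geodesic_dist_le.
Qed.

Hypothesis cptM : compact [set: M].

(** A real [sup] is an upper bound only for a bounded set. The bound is twice the maximum of the
    continuous function [d _ y] on the compact space. *)
Lemma geodesic_dist_le_diameter x y : d x y <= diameter g.
Proof.
have cd : {within [set: M], continuous (fun x => d x y)}.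
  by apply: continuous_subspaceT; exact: geodesic_dist_continuous.
have [z _ zmax] := @compact_EVT_max _ _ _ _ (ex_intro _ y I) cptM cd.
apply: ub_le_sup; last by exists (x, y).
exists (2 * d z y) => _ [[u v] _ <-]/=.
have := geodesic_dist_triangle y u v; rewrite (geodesic_dist_sym y v).
by have := zmax u (mem_set I); have := zmax v (mem_set I); lra.
Qed.

Lemma geodesic_dist_ivt x y r : 0 <= r <= d y x -> exists z, d z x = r.
Proof.
move=> /andP[r0 r1]; have [c [cc c0 c1]] := path_connected x y.
have cdc : {within `[0, 1], continuous (fun t => d (c t) x)}.
  apply/subspace_continuousP => t t01; move/subspace_continuousP : cc => /(_ _ t01) ct.
  exact: (cvg_comp _ _ ct (@geodesic_dist_continuous x (c t))).
have := @IVT _ _ 0 1 r ler01 cdc; rewrite c0 c1 geodesic_distxx.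
rewrite minEle maxEle geodesic_dist_ge0 r0 r1 => /(_ isT)[t _ <-].
by exists (c t).
Qed.

End distance.

(** * Positivity of the geodesic distance *)

(** Squaring the positive part makes the truncation C^1: at 0 the difference quotient is at most
    [|h|] in absolute value. *)
Lemma is_derive_sqr_pos (R : realType) (u : R) :
  is_derive u 1 (fun s : R => Num.max 0 s ^+ 2) (2 * Num.max 0 u).
Proof.
have [u0|u0|->] := ltrgtP u 0.
- have nE : {near u, cst (0 : R) =1 fun s : R => Num.max 0 s ^+ 2}.
    near=> s; rewrite /= max_l ?expr0n//; apply/ltW; near: s.
    exact: lt_nbhsl.
  rewrite mulr0.
  by apply: near_eq_is_derive nE _; exact: is_derive_cst.
- have nE : {near u, (fun s : R => s ^+ 2) =1 fun s : R => Num.max 0 s ^+ 2}.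
    near=> s; rewrite /= max_r//; apply/ltW; near: s.
    exact: lt_nbhsr.
  apply: near_eq_is_derive nE _.
  apply: DeriveDef; first exact: exprn_derivable.
  by rewrite exp_derive/= expr1 [_ *: 1]mulr1.
- rewrite mulr0.
  have cv : (fun h : R => h^-1 *:
      (Num.max 0 (h *: (1 : R) + 0) ^+ 2 - Num.max 0 (0 : R) ^+ 2)) @ (0 : R)^' --> (0 : R).
    apply/cvgrPdist_le => e e0; near=> h.
    rewrite maxxx expr0n subr0 addr0 sub0r normrN [_ *: 1]mulr1 normrM normfV.
    have h0 : 0 < `|h| by rewrite normr_gt0; near: h; exact: nbhs_dnbhs_neq.
    rewrite ler_pdivrMl// normrX.
    apply: (@le_trans _ _ (`|h| ^+ 2)).
      rewrite lerXn2r ?nnegrE// ger0_norm ?le_max ?lexx//.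
      by rewrite ge_max normr_ge0 ler_norm.
    rewrite expr2 ler_wpM2l//.
    near: h; apply: dnbhs0_le; exact: e0.
  apply: DeriveDef; last exact: cvg_lim cv.
  by apply/cvg_ex; exists 0.
Unshelve. all: by end_near. Qed.

Section sqdist.
Context (R : realType) (m : nat) (y : 'rV[R]_m).

(** The norm on ['rV] is the sup norm, which is not differentiable; the squared Euclidean distance
    is. *)
Definition sqdist (z : 'rV[R]_m) : R := \sum_k (z 0 k - y 0 k) ^+ 2.

Lemma sqdist_ge0 z : 0 <= sqdist z.
Proof. by apply: sumr_ge0 => k _; exact: sqr_ge0. Qed.

Lemma entry_sqdist (z : 'rV[R]_m) k : (z 0 k - y 0 k) ^+ 2 <= sqdist z.
Proof.
rewrite /sqdist (bigD1 k)//= lerDl sumr_ge0// => j _; exact: sqr_ge0.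
Qed.

Lemma sqdist_cvg (T : Type) (F : set_system T) (FF : Filter F)
  (w : T -> 'rV[R]_m) w0 : w @ F --> w0 -> sqdist (w s) @[s --> F] --> sqdist w0.
Proof.
move=> cw; apply: cvg_big => [|k _]; first exact: add_continuous.
have cwk : w s 0 k - y 0 k @[s --> F] --> w0 0 k - y 0 k.
  apply: cvgB; last exact: cvg_cst.
  exact: (cvg_comp _ _ cw (@matrix_normedtype.coord_continuous _ _ _ 0 k w0)).
exact: (cvg_comp _ _ cwk (@exprn_continuous _ 2 _)).
Qed.

(** The differential of [sqdist y] at [z], applied to [v]. *)
Definition dsqdist (z v : 'rV[R]_m) : R := \sum_k 2 * (z 0 k - y 0 k) * v 0 k.

Lemma is_derive_sqdist (w : R -> 'rV[R]_m) t : derivable w t 1 ->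
  is_derive t 1 (sqdist \o w) (dsqdist (w t) (derive1 w t)).
Proof.
move=> dw.
have dwk k : is_derive t 1 (fun s => w s 0 k) (derive1 w t 0 k).
  rewrite derive1E derive_mx// mxE; apply: derivableP.
  by move/derivable_mxP : dw; exact.
have -> : sqdist \o w = \sum_k (fun s => (w s 0 k - y 0 k) ^+ 2).
  by apply/funext => s; rewrite fct_sumE.
apply: is_derive_sum => k.
have h := is_deriveB (dwk k) (is_derive_cst (y 0 k) t 1).
have h2 := is_deriveM h h.
have -> : 2 * (w t 0 k - y 0 k) * derive1 w t 0 k =
    (w t 0 k - y 0 k) * (derive1 w t 0 k - 0) +
    (w t 0 k - y 0 k) * (derive1 w t 0 k - 0) by ring.
exact: h2.
Qed.

Lemma dsqdist_bound z v (rho : R) : rho <= 1 -> sqdist z <= rho ->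
  `|dsqdist z v| <= 2 * m%:R * `|v|.
Proof.
move=> rho1 zrho; apply: le_trans (ler_norm_sum _ _ _) _.
apply: (@le_trans _ _ (\sum_(k < m) 2 * `|v|)); last first.
  by rewrite sumr_const card_ord -[leLHS]mulr_natl mulrCA mulrA.
apply: ler_sum => k _; rewrite !normrM (ger0_norm (_ : 0 <= 2))//.
rewrite -mulrA ler_wpM2l// -[leRHS]mul1r ler_pM ?entry_le_norm//.
(* Since [rho <= 1], each coordinate difference is at most 1. *)
rewrite -(@ler_pXn2r _ 2) ?nnegrE// real_normK ?num_real// expr1n.
by apply: le_trans (entry_sqdist _ _) _; exact: le_trans zrho _.
Qed.

Lemma dsqdist_cvg (T : Type) (F : set_system T) (FF : Filter F)
  (w v : T -> 'rV[R]_m) w0 v0 : w @ F --> w0 -> v @ F --> v0 ->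
  dsqdist (w s) (v s) @[s --> F] --> dsqdist w0 v0.
Proof.
move=> cw cv; apply: cvg_big => [|k _]; first exact: add_continuous.
apply: cvgM.
  apply: cvgM; first exact: cvg_cst.
  apply: cvgB; last exact: cvg_cst.
  exact: (cvg_comp _ _ cw (@matrix_normedtype.coord_continuous _ _ _ 0 k w0)).
exact: (cvg_comp _ _ cv (@matrix_normedtype.coord_continuous _ _ _ 0 k v0)).
Qed.

End sqdist.

(** By homogeneity, the minimum over the compact unit sphere is such a constant. *)
Lemma qform_posdef_bound (R : realType) m (G : 'M[R]_m) :
  (forall v, v != 0 -> 0 < qform G v) ->
  exists2 l : R, 0 < l & forall v, l * `|v| ^+ 2 <= qform G v.
Proof.
move=> posG.
have q0 : qform G 0 = 0 by rewrite /qform mul0mx mul0mx mxE.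
have [[v0 v0n0]|] := pselect (exists v : 'rV[R]_m, v != 0); last first.
  (* In dimension 0 the sphere is empty and any constant works. *)
  move=> nv; exists 1 => // v; have -> : v = 0.
    by apply/eqP/negPn/negP => v0; apply: nv; exists v.
  by rewrite q0 normr0 expr0n mulr0.
pose S := [set v : 'rV[R]_m | `|v| = 1].
have nS v : v != 0 -> S (`|v|^-1 *: v).
  by move=> vn0; rewrite /S /= normrZ normfV normr_id mulVf// normr_eq0.
have cS : compact S.
  apply: bounded_closed_compact.
    by exists 1; split=> // x x1 v /= ->; exact: ltW.
  apply: (@closed_comp _ _ (fun v : 'rV[R]_m => `|v|) [set x : R | x = 1]).
    by move=> v _; exact: norm_continuous.
  exact: closed_eq.
have cq : continuous (qform G).
  move=> v; apply: (@cvg_qform _ _ _ (nbhs v) _ (cst G) id); last exact: cvg_id.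
  exact: cvg_cst.
have [v1 /set_mem v1S v1min] := @EVT_min_rV R m (qform G) S
  (ex_intro _ _ (nS _ v0n0)) cS
  (continuous_subspaceT cq).
exists (qform G v1) => [|v].
  by apply: posG; rewrite -normr_eq0 v1S oner_eq0.
have [->|vn0] := eqVneq v 0; first by rewrite normr0 expr0n mulr0 q0.
have := v1min _ (mem_set (nS _ vn0)).
rewrite /qform linearZ/= -!scalemxAl -scalemxAr !mxE mulrA -expr2.
by rewrite exprVn ler_pdivlMl ?exprn_gt0 ?normr_gt0// mulrC.
Qed.

(** * A bump function whose variation is bounded by the length of curves *)

Section bump.
Context (R : realType) (m : nat) (M : topologicalType).
Variables (A : smooth_atlas R m M) (g : riemannian_metric A).
Variables (i : chart A) (y : 'rV[R]_m) (rho kappa : R).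

Local Notation crd := (@Defs.coord R m M A).
Local Notation par := (@param R m M A).

Hypothesis rho1 : rho <= 1.
Hypothesis kappa0 : 0 <= kappa.
Hypothesis ball_dom : forall z, sqdist y z <= rho -> (crd i @` dom i) z.
Hypothesis ball_metric : forall z v, sqdist y z <= rho ->
  `|v| ^+ 2 <= kappa ^+ 2 * qform (gram g i z) v.

(** A curve may leave the chart, so the function is defined on all of [M]. It is positive exactly on
    the points of the chart with [sqdist] less than [rho]. *)
Definition bump (x : M) : R :=
  if x \in dom i then Num.max 0 (rho - sqdist y (crd i x)) ^+ 2 else 0.

Lemma bumpE x : dom i x -> bump x = Num.max 0 (rho - sqdist y (crd i x)) ^+ 2.
Proof. by move=> dx; rewrite /bump mem_set. Qed.

Lemma compact_sqdist_ball : compact [set z | sqdist y z <= rho].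
Proof.
apply: bounded_closed_compact.
  exists (`|y| + 1); split=> // x x1 z /= zr; apply: le_trans (ltW x1).
  rewrite -[z](subrK y) addrC; apply: le_trans (ler_normD _ _) _; rewrite lerD2l.
  rewrite [leLHS]mx_normrE; apply: bigmax_le => // -[k j] _ /=.
  rewrite (ord1 k) !mxE -(@ler_pXn2r _ 2) ?nnegrE// expr1n real_normK ?num_real//.
  by apply: le_trans (entry_sqdist _ _ _) _; exact: le_trans zr _.
apply: (@closed_comp _ _ (sqdist y) [set x : R | x <= rho]); last exact: closed_le.
by move=> z _; apply: (@sqdist_cvg _ _ _ _ (nbhs z) _ id); exact: cvg_id.
Qed.

(** A compact set is closed in the Hausdorff space [M]. Closedness in [M], and not just in the chart
    domain, is what lets the extension by zero stay C^1. *)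
Lemma bump_support_closed : closed (par i @` [set z | sqdist y z <= rho]).
Proof.
apply: compact_closed; first exact: atlas_hausdorff A.
apply: continuous_compact; last exact: compact_sqdist_ball.
apply/subspace_continuousP => z zr; apply: cvg_within_filter.
exact: param_continuous (ball_dom zr).
Qed.

Lemma bump_near0 x : ~ dom i x -> \forall x' \near x, bump x' = 0.
Proof.
move=> ndx.
have oC : open (~` (par i @` [set z | sqdist y z <= rho])).
  by apply: closed_openC; exact: bump_support_closed.
have : \forall x' \near x, (~` (par i @` [set z | sqdist y z <= rho])) x'.
  apply: open_nbhs_nbhs; split=> // -[z zr zx]; apply: ndx.
  by rewrite -zx; apply: param_dom; exact: ball_dom.
apply: filterS => x' nx'; rewrite /bump; case: ifPn => // /set_mem dx'.
rewrite max_l ?expr0n// subr_le0; apply/ltW; rewrite ltNge; apply/negP => zr.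
by apply: nx'; exists (crd i x') => //; exact: coordK.
Qed.

Definition dbump (c : R -> M) (s : R) : R := 2 * Num.max 0 (rho - sqdist y (crd i (c s))) *
  - dsqdist y (crd i (c s)) (derive1 (crd i \o c) s).

Lemma bump_derive (c : R -> M) (s : R) : (\forall s' \near s, dom i (c s')) ->
  derivable (crd i \o c) s 1 ->
  derivable (bump \o c) s 1 /\ dbump c s = derive1 (bump \o c) s.
Proof.
move=> nd dw; have q := is_derive_sqdist y dw.
have u := is_deriveB (is_derive_cst rho s 1) q; rewrite sub0r in u.
pose h := (cst rho - sqdist y \o (crd i \o c) : R -> R).
have dh : derivable h s 1 by exact: (@ex_derive _ _ _ _ _ _ _ u).
have p := is_derive_sqr_pos (h s).
have dp : derivable (fun r : R => Num.max 0 r ^+ 2) (h s) 1.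
  exact: (@ex_derive _ _ _ _ _ _ _ p).
have nE : {near s, (fun r : R => Num.max 0 r ^+ 2) \o h =1 bump \o c}.
  by apply: filterS nd => s' ds'; rewrite /= bumpE.
split.
  apply: near_eq_derivable nE _.
  exact: (derive1_compE dh ((derivable1_diffP _ _).1 dp)).1.
have eu : derive1 h s = - dsqdist y (crd i (c s)) (derive1 (crd i \o c) s).
  by rewrite derive1E; exact: (@derive_val _ _ _ _ _ _ _ u).
have ep : derive1 (fun r : R => Num.max 0 r ^+ 2) (h s) = 2 * Num.max 0 (h s).
  by rewrite derive1E; exact: (@derive_val _ _ _ _ _ _ _ p).
by rewrite -(near_eq_derive1 nE) (derive1_comp dh dp) ep eu.
Qed.

(** The positive part is at most [rho <= 1], giving [2 * 1]; [dsqdist] gives [2 m |w|]; and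
    [ball_metric] bounds the coordinate velocity [w] by [kappa] times the speed. *)
Lemma dbump_bound (c : R -> M) (t : R) : {for t, continuous c} -> dom i (c t) ->
  derivable (crd i \o c) t 1 -> rho >= 0 ->
  `|dbump c t| <= 4 * m%:R * kappa * speed g c t.
Proof.
move=> ct dt dw rho0.
have sp0 := speed_ge0 g c t.
(* Outside the coordinate ball the positive part vanishes, and with it [dbump]. *)
have [zr|zr] := leP (sqdist y (crd i (c t))) rho; last first.
  rewrite /dbump max_l ?subr_le0 ?(ltW zr)// mulr0 mul0r normr0.
  by rewrite !mulr_ge0.
set w := derive1 (crd i \o c) t.
have wk : `|w| <= kappa * speed g c t.
  rewrite (speed_chart g ct dt dw) /chart_speed -/w.
  have q0 : 0 <= qform (gram g i (crd i (c t))) w.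
    have [->|w0] := eqVneq w 0; first by rewrite /qform !mul0mx mxE.
    by apply/ltW; exact: gram_posdef (image_coord dt) _ w0.
  rewrite -(@ler_pXn2r _ 2) ?nnegrE ?mulr_ge0 ?sqrtr_ge0//.
  by rewrite exprMn sqr_sqrtr//; exact: ball_metric.
rewrite /dbump !normrM normrN (ger0_norm (_ : 0 <= 2))//.
have r0 := sqdist_ge0 y (crd i (c t)).
rewrite (ger0_norm (_ : 0 <= Num.max _ _)) ?le_max ?lexx//.
rewrite max_r ?subr_ge0//.
apply: (@le_trans _ _ (2 * 1 * (2 * m%:R * `|w|))); last first.
  have : 0 <= (m%:R : R) by [].
  move: wk; move: (`|w|) (speed g c t) => a b; nra.
apply: ler_pM => //; first by rewrite mulr_ge0// subr_ge0.
  rewrite ler_wpM2l// lerBlDr; apply: le_trans rho1 _; by rewrite lerDl.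
exact: dsqdist_bound rho1 zr.
Qed.

Lemma bump_curve (c : R -> M) (t : R) : 0 <= rho -> C1_curve A c -> 0 <= t <= 1 ->
  [/\ derivable (bump \o c) t 1, {for t, continuous (derive1 (bump \o c))} &
      `|derive1 (bump \o c) t| <= 4 * m%:R * kappa * speed g c t].
Proof.
move=> rho0 cC t01; have [ct di] := cC _ t01.
have [dt|ndt] := pselect (dom i (c t)); last first.
  have n0 : {near t, cst 0 =1 bump \o c}.
    have nb : \forall s \near t, bump (c s) = 0 := ct _ (bump_near0 ndt).
    by apply: filterS nb => s /= ->.
  have nd : {near t, cst 0 =1 derive1 (bump \o c)}.
    apply: filterS (nbhs_interior n0) => s ns.
    by rewrite -(near_eq_derive1 ns) derive1_cst.
  split.
  - by apply: near_eq_derivable n0 _; exact: derivable_cst.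
  - have cv : (cst 0 : R -> R) @ t --> derive1 (bump \o c) t.
      by rewrite -(nbhs_singleton nd); exact: cvg_cst.
    exact: (cvg_trans (near_eq_cvg nd) cv).
  - by rewrite -(nbhs_singleton nd) normr0 !mulr_ge0// speed_ge0.
have [dw dc] := di _ dt.
have nd := near_curve_dom ct dt.
have nD : {near t, dbump c =1 derive1 (bump \o c)}.
  by apply: filterS2 dw (nbhs_interior nd) => s ds ns; have [] := bump_derive ns ds.
have [db Db] := bump_derive nd (nbhs_singleton dw).
split; [exact: db| |by rewrite -Db; exact: dbump_bound ct dt (nbhs_singleton dw) rho0].
have cw : crd i (c s) @[s --> t] --> crd i (c t).
  by apply: (cvg_comp _ _ ct); exact: Defs.coord_continuous.
have cv : dbump c @ t --> derive1 (bump \o c) t.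
  rewrite -Db; apply: cvgM.
    apply: cvgM; first exact: cvg_cst.
    have cr : rho - sqdist y (crd i (c s)) @[s --> t] --> rho - sqdist y (crd i (c t)).
      by apply: cvgB; [exact: cvg_cst|exact: sqdist_cvg].
    apply: (cvg_comp _ _ cr).
    exact: (@continuous_max _ _ (cst 0) id _ (@cst_continuous _ _ _ _) (@cvg_id _ _)).
  by apply: cvgN; apply: dsqdist_cvg.
exact: (cvg_trans (near_eq_cvg nD) cv).
Qed.

Lemma bump_length (c : R -> M) : 0 <= rho -> C1_curve A c ->
  `|bump (c 1) - bump (c 0)| <= 4 * m%:R * kappa * C1_length g c.
Proof.
move=> rho0 cC; have bc t (t01 : 0 <= t <= 1) := bump_curve rho0 cC t01.
have i0 : 0 <= (0 : R) <= 1 by apply/andP; split.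
have i1 : 0 <= (1 : R) <= 1 by apply/andP; split.
have cd : {within `[0, 1], continuous (derive1 (bump \o c))}.
  apply: continuous_in_subspaceT => t /set_mem/itv01P t01.
  by have [_ dc _] := bc _ t01; exact: dc.
have cb t : 0 <= t <= 1 -> {for t, continuous (bump \o c)}.
  move=> t01; have [/derivable1_diffP db _ _] := bc _ t01.
  exact: differentiable_continuous.
have lr : derivable_oo_LRcontinuous (bump \o c) 0 1.
  split.
  - move=> t; rewrite in_itv/= => /andP[t0 t1].
    have t01 : 0 <= t <= 1 by rewrite (ltW t0) (ltW t1).
    by have [db _ _] := bc t t01; exact: db.
  - by apply: cvg_at_right_filter; exact: cb.
  - by apply: cvg_at_left_filter; exact: cb.
(* The variation along the curve is the integral of the derivative, which [bump_curve] compares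
   pointwise with the speed. *)
have ftc := continuous_FTC2 ltr01 cd lr (fun _ _ => erefl).
have idb : lebesgue_measure.-integrable `[0%R, 1%R] (EFin \o derive1 (bump \o c)).
  by apply: continuous_compact_integrable => //; exact: segment_compact.
have -> : bump (c 1) - bump (c 0) =
    \int[lebesgue_measure]_(t in `[0, 1]) derive1 (bump \o c) t.
  by rewrite /Rintegral ftc.
apply: le_trans (le_normr_Rintegral _ idb) _ => //.
have isp := speed_integrable g cC.
have ik : lebesgue_measure.-integrable `[0%R, 1%R]
    (EFin \o (fun t => 4 * m%:R * kappa * speed g c t)).
  apply: continuous_compact_integrable; first exact: segment_compact.
  move=> t; apply: cvgM; first exact: cvg_cst.
  exact: (@speed_continuous _ _ _ _ g _ cC t).
rewrite /C1_length -RintegralZl//; apply: le_Rintegral => //.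
- exact: integrable_norm.
- by move=> t /itv01P t01; have [_ _ db] := bc _ t01; exact: db.
Qed.

Lemma bump_piecewise x x' L : 0 <= rho -> piecewise_C1 g x x' L ->
  `|bump x' - bump x| <= 4 * m%:R * kappa * L.
Proof.
move=> rho0; elim=> [z|c z K cC _ IH]; first by rewrite subrr normr0 mulr0.
have := bump_length rho0 cC.
rewrite mulrDr => H; rewrite -[bump z](subrK (bump (c 1))) -addrA addrC.
by apply: le_trans (ler_normD _ _) _; rewrite lerD.
Qed.

End bump.

Lemma sqdist_le_ball (R : realType) m (y z : 'rV[R]_m) (r : R) : 0 < r ->
  sqdist y z <= (r / 2) ^+ 2 -> ball y r z.
Proof.
move=> r0 zr; rewrite -ball_normE /= [ltLHS]mx_normrE.
apply: bigmax_lt => // -[k j] _ /=; rewrite (ord1 k) !mxE distrC.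
apply: (@le_lt_trans _ _ (r / 2)); last lra.
rewrite -(@ler_pXn2r _ 2) ?nnegrE//; last lra.
by rewrite real_normK ?num_real//; apply: le_trans (entry_sqdist _ _ _) zr.
Qed.

Lemma qformD (R : realType) m (G H : 'M[R]_m) v :
  qform (G + H) v = qform G v + qform H v.
Proof. by rewrite /qform mulmxDr mulmxDl mxE. Qed.

Lemma qform_gt0 (R : realType) (m : nat) (M : topologicalType)
    (A : smooth_atlas R m M) (g : riemannian_metric A) (i : chart A) z v :
  (@Defs.coord R m M A i @` dom i) z -> v != 0 -> 0 < qform (gram g i z) v.
Proof. by move=> Uz v0; exact: gram_posdef Uz _ v0. Qed.

(** A bump centred at [a] takes a smaller value at a nearby point [x1]. Since its variation is at
    most [K] times the length of a curve, curves from [x1] to [a] cannot be arbitrarily short. *)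
Lemma geodesic_dist_gt0 (R : realType) (m : nat) (M : topologicalType)
    (A : smooth_atlas R m M) (g : riemannian_metric A) (a : M) :
  (0 < m)%N ->
  (forall x y : M, exists c : R -> M,
    [/\ {within `[0, 1], continuous c}, c 0 = x & c 1 = y]) ->
  exists x, 0 < geodesic_dist g x a.
Proof.
move=> m0 pc; pose i := chart_at A a; have da : dom i a by exact: dom_chart_at.
pose y := Defs.coord i a.
have Uy : (Defs.coord i @` dom i) y by exact: image_coord.
have [l l0 lG] := qform_posdef_bound (fun v => @qform_gt0 _ _ _ _ g i y v Uy).
have cg : {for y, continuous (gram g i)} by exact: (gram_smooth g i 0).
have m20 : 0 < (m%:R : R) ^+ 2 by rewrite exprn_gt0// ltr0n.
(* [qform_norm] costs a factor [m^2]; this tolerance perturbs the quadratic form by at most half of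
   its lower bound [l]. *)
have nG : \forall z \near y, `|gram g i y - gram g i z| <= l / 2 / m%:R ^+ 2.
  by move/cvgrPdist_le : cg; apply; rewrite !divr_gt0.
have nU : \forall z \near y, (Defs.coord i @` dom i) z.
  by apply: open_nbhs_nbhs; split=> //; exact: image_open.
have [r /= r0 rB] := (nbhs_ballP _ _).1 (filterI nG nU).
pose rho := Num.min 1 ((r / 2) ^+ 2).
have rho0 : 0 < rho by rewrite lt_min ltr01 exprn_gt0// divr_gt0.
have rho1 : rho <= 1 by rewrite ge_min lexx.
have rhoB z : sqdist y z <= rho -> ball y r z.
  by move=> zr; apply: sqdist_le_ball => //; apply: le_trans zr _; rewrite ge_min lexx orbT.
(* On the ball the form is still at least [l / 2] times the squared norm, whence
   [kappa^2 = 2 / l]. *)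
pose kappa := Num.sqrt (2 / l).
have kappaE : kappa ^+ 2 = 2 / l by rewrite sqr_sqrtr// divr_ge0// ltW.
have H1 z : sqdist y z <= rho -> (Defs.coord i @` dom i) z.
  by move=> /rhoB/rB[].
have H2 z v : sqdist y z <= rho -> `|v| ^+ 2 <= kappa ^+ 2 * qform (gram g i z) v.
  move=> /rhoB/rB[Gz _]; rewrite kappaE mulrAC ler_pdivlMr// mulrC.
  have := lG v; have := qform_norm (gram g i y - gram g i z) v.
  have := qformD (gram g i y - gram g i z) (gram g i z) v; rewrite subrK => ->.
  have h : `|gram g i y - gram g i z| * (m%:R * `|v|) ^+ 2 <= l / 2 * `|v| ^+ 2.
    rewrite exprMn mulrA ler_wpM2r ?exprn_ge0//.
    by rewrite -ler_pdivlMr.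
  by rewrite ler_norml => /andP[_ h1]; lra.
(* Any point of the ball other than [y] would do; [m > 0] ensures that this one differs from [y]. *)
pose s := r / 2; pose z1 := y + s *: const_mx 1.
have s0 : 0 < s by rewrite divr_gt0.
have z1B : ball y r z1.
  rewrite -ball_normE /= /z1 opprD addrA subrr sub0r normrN normrZ gtr0_norm//.
  apply: (@le_lt_trans _ _ (s * 1)); last by rewrite mulr1 /s; lra.
  rewrite ler_wpM2l ?(ltW s0)// [leLHS]mx_normrE; apply: bigmax_le => // -[k j] _ /=.
  by rewrite mxE normr1.
have [_ z1U] := rB _ z1B.
have q1 : 0 < sqdist y z1.
  apply: lt_le_trans (entry_sqdist y z1 (Ordinal m0)).
  by rewrite !mxE mulr1 addrAC subrr add0r exprn_gt0.
pose x1 := param i z1; exists x1.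
pose f := @bump R m M A i y rho.
have f1 : f x1 < f a.
  rewrite /f !bumpE//; last exact: param_dom.
  have -> : sqdist y (Defs.coord i a) = 0.
    by rewrite /sqdist big1// => k _; rewrite subrr expr0n.
  rewrite /x1 paramK// subr0 ltrXn2r// ?le_max ?lexx//.
  by rewrite gt_max (max_r (ltW rho0)) rho0/= ltrBlDr ltrDl.
pose K := 4 * m%:R * kappa; have K0 : 0 <= K by rewrite !mulr_ge0// sqrtr_ge0.
rewrite lt_neqAle geodesic_dist_ge0// andbT eq_sym; apply/eqP => d0.
(* The [+ 1] keeps the denominator positive whatever the value of [K]. *)
have e0 : 0 < (f a - f x1) / (K + 1) by rewrite divr_gt0 ?subr_gt0//; lra.
have [L pL Le] := geodesic_dist_adherent g pc x1 a e0.
have := bump_piecewise rho1 (sqrtr_ge0 _) H1 H2 (ltW rho0) pL; rewrite -/f -/K.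
rewrite d0 add0r ltr_pdivlMr in Le; last lra.
have L0 := piecewise_C1_ge0 pL.
by have := ler_norm (f a - f x1); lra.
Qed.

(** * The Riemannian volume *)

Lemma cvg_det (R : realType) m (T : Type) (F : set_system T) (FF : Filter F)
    (G : T -> 'M[R]_m) G0 : G @ F --> G0 -> \det (G x) @[x --> F] --> \det G0.
Proof.
move=> cG; apply: cvg_big => [|s _]; first exact: add_continuous.
apply: cvgM; first exact: cvg_cst.
apply: cvg_big => [|k _]; first exact: mul_continuous.
exact: (cvg_comp _ _ cG (@matrix_normedtype.coord_continuous _ _ _ k _ G0)).
Qed.

Lemma qformZ (R : realType) m (c : R) (G : 'M[R]_m) v :
  qform (c *: G) v = c * qform G v.
Proof. by rewrite /qform -scalemxAr -scalemxAl mxE. Qed.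

Lemma qform1_gt0 (R : realType) m (v : 'rV[R]_m) : v != 0 -> 0 < qform 1%:M v.
Proof.
move=> v0; rewrite /qform mulmx1 mxE lt_neqAle sumr_ge0 ?andbT; last first.
  by move=> k _; rewrite mxE -expr2 sqr_ge0.
rewrite eq_sym psumr_neq0; last by move=> k _; rewrite mxE -expr2 sqr_ge0.
have /existsP[k vk] : [exists k, v 0 k != 0].
  rewrite -negb_forall; apply: contra v0 => /forallP v0.
  by apply/eqP/rowP => k; rewrite mxE; exact/eqP.
by apply/hasP; exists k; rewrite ?mem_index_enum//= mxE -expr2 exprn_even_gt0.
Qed.

(* The segment from the identity to [G] consists of positive definite, hence
   invertible, matrices. *)
Lemma det_posdef (R : realType) m (G : 'M[R]_m) :
  (forall v, v != 0 -> 0 < qform G v) -> 0 < \det G.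
Proof.
move=> posG; pose H t : 'M[R]_m := (1 - t) *: 1%:M + t *: G.
have posH t v : 0 <= t <= 1 -> v != 0 -> 0 < qform (H t) v.
  move=> /andP[t0 t1] v0; rewrite qformD !qformZ.
  have g0 := posG _ v0; have o0 := qform1_gt0 v0.
  have [->|tn0] := eqVneq t 0; first by rewrite subr0 mul1r mul0r addr0.
  apply: ltr_wpDl; first by rewrite mulr_ge0 ?subr_ge0// ltW.
  by rewrite mulr_gt0// lt_neqAle eq_sym tn0.
have nz t : 0 <= t <= 1 -> \det (H t) != 0.
  move=> t01; apply/negP => /det0P[v v0 vH].
  by have := posH _ _ t01 v0; rewrite /qform vH mul0mx mxE ltxx.
have cH : {within `[0, 1], continuous (fun t => \det (H t))}.
  apply: continuous_subspaceT => t; apply: cvg_det.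
  apply: cvgD; apply: cvgZ; [|exact: cvg_cst|exact: cvg_id|exact: cvg_cst].
  by apply: cvgB; [exact: cvg_cst|exact: cvg_id].
have H0 : \det (H 0) = 1 by rewrite /H subr0 scale1r scale0r addr0 det1.
have H1 : H 1 = G by rewrite /H subrr scale0r scale1r add0r.
rewrite ltNge; apply/negP => G0.
have := @IVT _ _ 0 1 0 ler01 cH; rewrite H0 H1.
rewrite ge_min G0 orbT le_max ler01 => /(_ isT)[t].
by rewrite in_itv/= => /nz/eqP.
Qed.

Lemma lebesgue_measure_ball_gt0 (R : realType) (c r : R) : 0 < r ->
  lebesgue_measure (ball c r) = (r *+ 2)%:E.
Proof. by move=> r0; rewrite lebesgue_measure_ball// ltW. Qed.

Section volume.
Context (R : realType) (m : nat) (M : ptopologicalType).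
Variables (A : smooth_atlas R m M) (g : riemannian_metric A).
Variable vol : {sigma_finite_measure set (borel M) -> \bar R}.
Hypothesis volP : riemannian_volume g vol.

Local Notation crd := (@Defs.coord R m M A).
Local Notation par := (@param R m M A).

Lemma open_borel (B : set M) : open B -> measurable (B : set (borel M)).
Proof. exact: sub_sigma_algebra. Qed.

(** In a small chart ball the volume density [sqrt (det gram)] lies between two positive multiples
    of its value at the centre, and the ball has positive finite Lebesgue measure. *)
Lemma near_volume (x : M) : exists B : set (borel M),
  [/\ open (B : set M), B x, (0 < vol B)%E & (vol B < +oo)%E].
Proof.
pose i := chart_at A x; have dx : dom i x by exact: dom_chart_at.
pose y := crd i x; have Uy : (crd i @` dom i) y by exact: image_coord.
have cg : {for y, continuous (gram g i)} by exact: (gram_smooth g i 0).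
pose w z := Num.sqrt (\det (gram g i z)).
have wy : 0 < w y by rewrite sqrtr_gt0; apply: det_posdef => v; exact: qform_gt0.
have cw : w z @[z --> y] --> w y.
  have cd := @cvg_det R m _ _ (nbhs_filter y) _ _ cg.
  exact: (cvg_comp _ _ cd (@sqrt_continuous R _)).
have nw : \forall z \near y, `|w y - w z| <= w y / 2.
  by move/cvgrPdist_le : cw; apply; rewrite divr_gt0.
have nU : \forall z \near y, (crd i @` dom i) z.
  by apply: open_nbhs_nbhs; split=> //; exact: image_open.
have [r /= r0 rB] := (nbhs_ballP _ _).1 (filterI nw nU).
pose B := [set z | dom i z /\ ball y r (crd i z)].
have oB : open B.
  rewrite openE => z [dz bz]; apply: filterI.
    by apply: open_nbhs_nbhs; split=> //; exact: dom_open.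
  have := Defs.coord_continuous dz; apply.
  by apply: open_nbhs_nbhs; split=> //; exact: ball_open.
(* A sup-norm ball is a box, and this one lies entirely in the image of the chart. *)
have BE : [set t : m.-tuple (measurableTypeR R) | (crd i @` B) (row_of_tuple t)] =
    [set t | forall k, ball (y 0 k) r (tnth t k)].
  apply/seteqP; split=> t /=.
    move=> [z [dz [_ bz]] zt] k; have := bz 0 k.
    by rewrite zt mxE.
  move=> bt; have by_ : ball y r (row_of_tuple t).
    by split=> // k j; rewrite (ord1 k) mxE.
  have [_ Ut] := rB _ by_.
  exists (par i (row_of_tuple t)); last exact: paramK.
  by split; [exact: param_dom|rewrite paramK].
pose S := [set t : m.-tuple (measurableTypeR R) | forall k, ball (y 0 k) r (tnth t k)].
pose Q (k : 'I_m) : set (measurableTypeR R) := ball (y 0 k) r.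
have mQ k : measurable (Q k) by exact: measurable_ball.
have mS : measurable S.
  exact: (measurable_box mQ).
have volS : power_measure (@lebesgue_measure R) m S = (\prod_(k < m) (r *+ 2))%:E.
  apply: (power_measure_box (I := fun=> r *+ 2) mQ).
  by move=> k; exact: lebesgue_measure_ball_gt0.
have P0 : 0 < \prod_(k < m) (r *+ 2) by apply: prodr_gt0 => k _; rewrite mulrn_wgt0.
have wS t : S t -> w y / 2 <= w (row_of_tuple t) <= 2 * w y.
  move=> St; have [] := rB (row_of_tuple t).
    by split=> // k j; rewrite (ord1 k) mxE.
  by rewrite ler_norml => /andP[h1 h2] _; apply/andP; split; lra.
have volBE : vol B = (\int[power_measure (@lebesgue_measure R) m]_(t in S)
    (w (row_of_tuple t))%:E)%E.
  rewrite (volP (i := i))//; last by move=> z [].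
    by rewrite BE.
  exact: open_borel.
exists B; split=> //.
- by split=> //; exact: ballxx.
- rewrite volBE; apply: (@lt_le_trans _ _ ((w y / 2)%:E *
      power_measure (@lebesgue_measure R) m S)%E).
    by rewrite volS -EFinM lte_fin mulr_gt0// divr_gt0.
  rewrite -integral_cst//; apply: le_integral_ge0 => t St; rewrite lee_fin.
    by rewrite divr_ge0// ltW.
  by have /andP[] := wS _ St.
- rewrite volBE; apply: (@le_lt_trans _ _ ((2 * w y)%:E *
      power_measure (@lebesgue_measure R) m S)%E); last first.
    by rewrite volS -EFinM ltry.
  rewrite -integral_cst//; apply: le_integral_ge0 => t St; rewrite lee_fin.
    exact: sqrtr_ge0.
  by have /andP[] := wS _ St.
Qed.

Hypothesis cptM : compact [set: M].

Lemma volume_fin : (vol setT < +oo)%E.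
Proof.
have /choice[B BP] := near_volume.
move: cptM; rewrite compact_cover => /(_ M setT B).
case=> [x _|x _|D _ Dcov].
- by have [] := BP x.
- by exists x => //; have [] := BP x.
have : measurable (\big[setU/set0]_(x <- finmap.enum_fset D) B x) /\
    (vol (\big[setU/set0]_(x <- finmap.enum_fset D) B x) < +oo)%E.
  elim/big_ind : _ => [|C C' [mC fC] [mC' fC']|x _].
  - by split; [exact: measurable0|rewrite measure0 ltry].
  - split; first exact: measurableU.
    by apply: le_lt_trans (measureU2 _ mC mC') _; exact: lte_add_pinfty.
  - by have [oB _ _ fB] := BP x; split=> //; exact: open_borel.
move=> [_]; rewrite (_ : \big[_/_]_(_ <- _) _ = setT)//.
apply/seteqP; split=> // x _; have [z /= zD zx] := Dcov x I.
by rewrite -bigcup_seq; exists z.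
Qed.

Lemma volume_gt0 : (0 < vol setT)%E.
Proof.
have [B [oB _ B0 _]] := near_volume point; apply: lt_le_trans B0 _.
by apply: le_measure; rewrite ?inE//; exact: open_borel.
Qed.

End volume.

(** * The statistical model *)

Lemma continuous_borel (R : realType) (M : ptopologicalType) (f : M -> R) :
  continuous f -> measurable_fun [set: borel M] (f : borel M -> R).
Proof.
move=> cf; apply: (measurability _ (RGenOInfty.measurableE R)) => _ [_ [a ->] <-].
rewrite setTI; apply: sub_sigma_algebra.
by apply: open_comp => [x _|]; [exact: cf|exact: interval_open].
Qed.

(** One factor [E] is lost on the weights and one on the inverse normalizations, hence the
    square. *)
Lemma ratio_le (R : realType) (E za zb wa wb : R) :
  0 <= E -> 0 < za -> 0 < zb -> 0 <= wb -> E * wa <= wb -> E * zb <= za ->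
  E ^+ 2 * (za^-1 * wa) <= zb^-1 * wb.
Proof.
move=> E0 za0 zb0 wb0 hw hz.
have h : E / za <= zb^-1 by rewrite ler_pdivrMr// mulrC ler_pdivlMr.
apply: (@le_trans _ _ (E / za * wb)); last exact: ler_wpM2r.
rewrite (_ : E ^+ 2 * _ = E / za * (E * wa)); last by ring.
by rewrite ler_wpM2l// divr_ge0// ltW.
Qed.

Section model.
Context (R : realType) (m : nat) (M : ptopologicalType).
Variables (A : smooth_atlas R m M) (g : riemannian_metric A).
Variable vol : {sigma_finite_measure set (borel M) -> \bar R}.
Variables (phi : R -> R) (lip : R).
Hypothesis volP : riemannian_volume g vol.
Hypothesis path_connected : forall x y : M, exists c : R -> M,
  [/\ {within `[0, 1], continuous c}, c 0 = x & c 1 = y].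
Hypothesis cptM : compact [set: M].
Hypothesis phi0 : forall r, 0 <= r <= diameter g -> 0 <= phi r.
Hypothesis phi_mono : forall r s, 0 <= r <= diameter g ->
  0 <= s <= diameter g -> r <= s -> phi r <= phi s.
Hypothesis lip0 : 0 < lip.
Hypothesis phi_lip : forall r s, 0 <= r <= diameter g ->
  0 <= s <= diameter g -> `|phi r - phi s| <= lip * `|r - s|.

Local Notation d := (geodesic_dist g).

Lemma dist_range x a : 0 <= d x a <= diameter g.
Proof. by rewrite geodesic_dist_ge0//= geodesic_dist_le_diameter. Qed.

Lemma potential_lip x a b : `|phi (d x a) - phi (d x b)| <= lip * d a b.
Proof.
apply: le_trans (phi_lip (dist_range _ _) (dist_range _ _)) _.
rewrite ler_wpM2l ?(ltW lip0)// ![d x _]geodesic_dist_sym//.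
exact: geodesic_dist_lip.
Qed.

Lemma potential_continuous a : continuous (fun x => phi (d x a)).
Proof.
move=> x; apply/cvgrPdist_le => e e0.
have cd := @geodesic_dist_continuous _ _ _ _ g path_connected a x.
have e1 : 0 < e / lip by rewrite divr_gt0.
move/cvgrPdist_le : cd => /(_ _ e1); apply: filterS => z.
rewrite ler_pdivlMr// mulrC; apply: le_trans.
exact: phi_lip (dist_range _ _) (dist_range _ _).
Qed.

Let weight a x := expR (- phi (d x a)).

Lemma measurable_weight a : measurable_fun [set: borel M] (weight a : borel M -> R).
Proof.
apply: continuous_borel => x.
have cN : - phi (d z a) @[z --> x] --> - phi (d x a).
  by apply: cvgN; exact: potential_continuous.
exact: (cvg_comp _ _ cN (@continuous_expR R _)).
Qed.

(** [partition_function] is a real-valued integral, so finiteness has to be established first: the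
    weight is at most 1 and the total volume is finite. *)
Lemma integral_weight a : (\int[vol]_x (weight a x)%:E)%E =
  (partition_function g vol phi a)%:E.
Proof.
rewrite fineK// ge0_fin_numE; last first.
  by apply: integral_ge0 => x _; rewrite lee_fin expR_ge0.
apply: (@le_lt_trans _ _ (\int[vol]_(x in setT) (cst 1%:E) x)%E).
  apply: le_integral_ge0 => x _; rewrite lee_fin ?expR_ge0//.
  by rewrite -expR0 ler_expR oppr_le0; exact: phi0 (dist_range _ _).
by rewrite integral_cst// mul1e; exact: volume_fin volP cptM.
Qed.

Lemma partition_gt0 a : 0 < partition_function g vol phi a.
Proof.
rewrite -lte_fin -integral_weight.
(* As [phi] is nondecreasing, the weight is smallest at distance [diameter]. *)
apply: (@lt_le_trans _ _ (\int[vol]_(x in setT) (cst (expR (- phi (diameter g)))%:E) x)%E).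
  by rewrite integral_cst// mule_gt0 ?lte_fin ?expR_gt0//; exact: volume_gt0 volP.
apply: le_integral_ge0 => x _; rewrite lee_fin ?expR_ge0//.
have /andP[h1 h2] := dist_range x a.
rewrite ler_expR lerN2 phi_mono// ?h1//.
by apply/andP; split=> //; exact: le_trans h1 h2.
Qed.

Lemma density_ge0 a x : 0 <= density g vol phi a x.
Proof. by rewrite mulr_ge0 ?expR_ge0// invr_ge0 ltW// partition_gt0. Qed.

Lemma measurable_density a :
  measurable_fun [set: borel M] (density g vol phi a : borel M -> R).
Proof. by apply: measurable_funM => //; exact: measurable_weight. Qed.

Lemma integral_density a : (\int[vol]_x (density g vol phi a x)%:E = 1)%E.
Proof.
under eq_integral do rewrite EFinM.
rewrite ge0_integralZl_EFin//.
- by rewrite integral_weight -EFinM mulVf// gt_eqF// partition_gt0.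
- by apply/measurable_EFinP; exact: measurable_weight.
- by rewrite invr_ge0 ltW// partition_gt0.
Qed.

Lemma weight_ratio a b x : expR (- (lip * d a b)) * weight a x <= weight b x.
Proof.
rewrite -expRD ler_expR; have := potential_lip x a b.
by rewrite ler_norml => /andP[h1 h2]; lra.
Qed.

Lemma partition_ratio a b :
  expR (- (lip * d a b)) * partition_function g vol phi a <=
  partition_function g vol phi b.
Proof.
rewrite -lee_fin EFinM -(integral_weight a) -(integral_weight b).
rewrite -ge0_integralZl_EFin; last exact: expR_ge0.
- apply: le_integral_ge0 => x _; rewrite -EFinM lee_fin; last exact: weight_ratio.
  by apply: mulr_ge0; exact: expR_ge0.
- exact: measurableT.
- by move=> x _; rewrite lee_fin expR_ge0.
- by apply/measurable_EFinP; exact: measurable_weight.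
Qed.

(** Uses [1 - e <= expR (- e)]; the condition [e <= 1] makes the left side nonnegative, so that the
    inequality can be squared. *)
Lemma density_ratio a b x : lip * d a b <= 1 ->
  (1 - lip * d a b) ^+ 2 * density g vol phi a x <= density g vol phi b x.
Proof.
move=> e1; set e := lip * d a b.
have Za := partition_gt0 a; have Zb := partition_gt0 b.
have h : expR (- e) ^+ 2 * density g vol phi a x <= density g vol phi b x.
  apply: ratio_le; [exact: expR_ge0|exact: Za|exact: Zb|exact: expR_ge0| |].
    exact: weight_ratio.
  by rewrite /e geodesic_dist_sym; first exact: partition_ratio.
apply: le_trans h; rewrite ler_wpM2r ?density_ge0// lerXn2r ?nnegrE ?expR_ge0 ?subr_ge0//.
exact: expR_ge1Dx.
Qed.

Lemma risk_lower_bound n (est : n.-tuple (borel M) -> borel M) a b :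
  measurable_fun setT est -> lip * d a b <= 2^-1 ->
  n%:R * (lip * d a b) ^+ 2 <= 4^-1 ->
  ((d a b / 8)%:E <= risk g vol phi est a + risk g vol phi est b)%E.
Proof.
move=> mest e1 ne.
have md c : measurable_fun [set: borel M] ((fun x => d x c) : borel M -> R).
  by apply: continuous_borel; exact: geodesic_dist_continuous.
apply: (@two_point_bound _ _ _ vol n (density g vol phi a) (density g vol phi b)
  (fun t => d (est t) a) (fun t => d (est t) b) (d a b) (lip * d a b)) => //.
- exact: measurable_density.
- exact: measurable_density.
- exact: (measurableT_comp (md a) mest).
- exact: (measurableT_comp (md b) mest).
- exact: density_ge0.
- exact: density_ge0.
- by move=> t; exact: geodesic_dist_ge0.
- by move=> t; exact: geodesic_dist_ge0.
- exact: integral_density.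
- exact: integral_density.
- by rewrite e1 mulr_ge0 ?(ltW lip0)// geodesic_dist_ge0.
- by move=> x; apply: density_ratio; lra.
- move=> x; rewrite geodesic_dist_sym//; apply: density_ratio.
  by rewrite geodesic_dist_sym//; lra.
- exact: geodesic_dist_ge0.
(* An estimate cannot be close to both centres: the triangle inequality through [est t]. *)
- move=> t; rewrite [d (est t) a]geodesic_dist_sym//.
  exact: geodesic_dist_triangle.
Qed.

End model.

(** * Choice of the two centres and conclusion *)

Theorem theorem5p9 (R : realType) (m : nat) (M : ptopologicalType)
  (A : smooth_atlas R m M) (g : riemannian_metric A)
  (vol : {sigma_finite_measure set (borel M) -> \bar R})
  (phi : R -> R) (astar : M) (D : R) :
  (2 <= m)%N ->
  simply_connected R M ->
  compact [set: M] ->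
  symmetric_space g ->
  riemannian_volume g vol ->
  let rM := diameter g in
  (forall r, r \in `[0, rM] -> 0 <= phi r) ->
  {in `[0, rM] &, {homo phi : r s / r <= s}} ->
  [lipschitz phi r | r in [set` `[0, rM]]] ->
  (forall r, r \in `]0, rM[ ->
     [/\ derivable phi r 1, derivable (derive1 phi) r 1 &
         {for r, continuous (derive1 (derive1 phi))}]) ->
  [bounded derive1 phi r | r in [set` `]0, rM[]] ->
  (\int[lebesgue_measure]_(r in [set` `]0%R, rM[])
     (`|derive1 (derive1 phi) r| * r ^+ m.-1)%:E < +oo)%E ->
  0 < D ->
  let X := [set a | geodesic_dist g a astar < D] in
  exists2 C : R, 0 < C &
    \forall n \near \oo,
      ((C * n%:R `^ (- 2^-1))%:E <= minimax_risk g vol phi X n)%E.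

Proof.
move=> m2 [pc _] cptM _ volP /= phi0 phi_mono phi_lip _ _ _ D0.
have m0 : (0 < m)%N by exact: leq_trans m2.
have [lip lip0 lipP] := pinfty_ex_gt0 phi_lip.
have phi0' r : 0 <= r <= diameter g -> 0 <= phi r.
  by move=> r0; apply: phi0; rewrite in_itv.
have phi_mono' r s : 0 <= r <= diameter g -> 0 <= s <= diameter g ->
    r <= s -> phi r <= phi s.
  by move=> r0 s0; apply: phi_mono; rewrite in_itv.
have phi_lip' r s : 0 <= r <= diameter g -> 0 <= s <= diameter g ->
    `|phi r - phi s| <= lip * `|r - s|.
  move=> r0 s0; apply: (lipP (r, s)).
  by split; rewrite /= in_itv.
have [x x0] := geodesic_dist_gt0 g astar m0 pc.
set d := geodesic_dist g in x0 *.
(* The three bounds serve in turn to realise the distance [c / sqrt n] on a path from [x] to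
   [astar], to keep the second centre in the ball of radius [D], and to get [lip * c <= 1/2]. *)
pose c := Num.min (Num.min (d x astar) (D / 2)) (2 * lip)^-1.
have c0 : 0 < c by rewrite !lt_min x0 divr_gt0//= invr_gt0 mulr_gt0.
have cx : c <= d x astar by rewrite !ge_min lexx.
have cD : c < D.
  by apply: (@le_lt_trans _ _ (D / 2)); [rewrite !ge_min lexx orbT|lra].
have cl : lip * c <= 2^-1.
  by rewrite mulrC -ler_pdivlMr// -invfM !ge_min lexx !orbT.
(* [16 = 2 * 8]: the sum of the two risks is at least [delta / 8], and the supremum is at least half
   of the sum. *)
exists (c / 16); first by rewrite divr_gt0.
near=> n; have n0 : (0 < n)%N by near: n; exact: nbhs_infty_gt.
have nR : 1 <= (n%:R : R) by rewrite ler1n.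
pose s := Num.sqrt (n%:R : R); have s2 : s ^+ 2 = n%:R by rewrite sqr_sqrtr.
have s1 : 1 <= s by rewrite -[1]sqrtr1 ler_sqrt// ler0n.
have s0 : 0 < s by lra.
rewrite powRN powR12_sqrt// -/s.
pose delta := c / s.
have delta0 : 0 <= delta by rewrite divr_ge0// ltW.
have deltac : delta <= c by rewrite ler_pdivrMr// ler_peMr// ltW.
have [b bE] : exists b, d b astar = delta.
  by apply: (geodesic_dist_ivt pc (y := x)); rewrite delta0 (le_trans deltac).
have ld : lip * delta <= 2^-1.
  by apply: le_trans cl; rewrite ler_wpM2l// ltW.
(* The factor [n] cancels the square of [1 / sqrt n], leaving [(lip * c)^2 <= 1/4] for every
   [n >= 1]. *)
have nld : n%:R * (lip * delta) ^+ 2 <= 4^-1.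
  have -> : n%:R * (lip * delta) ^+ 2 = (lip * c) ^+ 2.
    rewrite /delta -s2; field; exact: lt0r_neq0.
  have : 0 <= lip * c by rewrite mulr_ge0// ltW.
  by move: cl; set z := lip * c; nra.
apply: le_ereal_inf_tmp => _ [est mest <-].
have := risk_lower_bound volP pc cptM phi0' phi_mono' lip0 phi_lip'
  (a := b) (b := astar) mest.
rewrite -/d bE => /(_ ld nld) H.
have ub a : d a astar < D -> (risk g vol phi est a <=
    ereal_sup [set risk g vol phi est a | a in [set a | (d a astar < D)%R]])%E.
  by move=> aD; apply: ereal_sup_ubound; exists a.
have ubb : (risk g vol phi est b <=
    ereal_sup [set risk g vol phi est a | a in [set a | (d a astar < D)%R]])%E.
  by apply: ub; rewrite bE; exact: le_lt_trans cD.
have uba : (risk g vol phi est astar <=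
    ereal_sup [set risk g vol phi est a | a in [set a | (d a astar < D)%R]])%E.
  by apply: ub; rewrite /d geodesic_distxx.
move: (le_trans H (leeD ubb uba)).
rewrite (_ : c / 16 / s = delta / 16); last by rewrite /delta mulrAC.
(* The supremum may be infinite: [+oo] satisfies the bound trivially, and [-oo] would contradict the
   lower bound on the sum. *)
case: (ereal_sup _) => [r|_|]; [|by rewrite leey|by rewrite addNye leeNy_eq].
by rewrite -EFinD !lee_fin; lra.
Unshelve. all: by end_near. Qed.
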